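(* Let $\Lambda=\{1,\ldots,N_s\}$ with $N_s$ even and periodic boundary conditions, $t>0$, $t'>0$, and $$H=-t\sum_{x=1}^{N_s}\sum_{\sigma}(c^\dagger_{x,\sigma}c_{x+1,\sigma}+c^\dagger_{x+1,\sigma}c_{x,\sigma})+t'\sum_{j=1}^{N_s/2}\sum_{\sigma}(c^\dagger_{2j,\sigma}c_{2j+2,\sigma}+c^\dagger_{2j+2,\sigma}c_{2j,\sigma})+U\sum_{x}n_{x,\uparrow}n_{x,\downarrow}+V\Big\{\sum_{x=1}^{N_s}n_xn_{x+1}-(2N_e-N_s)\Big\}.$$ Let the electron number $N_e$ be odd with $N_s>N_e>N_s/2$, and take the limits $U\to\infty$, $V\to\infty$. Then the ground states have total spin $S_{\rm tot}=S_{\max}=N_e/2$ and are nondegenerate apart from the trivial $(2S_{\max}+1)$-fold degeneracy.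
   Context: $c_{x,\sigma}$ are fermion annihilation operators ($x\in\Lambda$, $\sigma\in\{\uparrow,\downarrow\}$) with canonical anticommutation relations and vacuum $\Phi_{\rm vac}$; $\mathcal H_{N_e}$ is the span of $c^\dagger_{x_1,\sigma_1}\cdots c^\dagger_{x_{N_e},\sigma_{N_e}}\Phi_{\rm vac}$; $n_{x,\sigma}=c^\dagger_{x,\sigma}c_{x,\sigma}$, $n_x=n_{x,\uparrow}+n_{x,\downarrow}$. The limit $U,V\to\infty$ means: let $P$ be the orthogonal projection onto the span of states with no doubly occupied site and with $\sum_x n_xn_{x+1}=2N_e-N_s$ (its minimal possible value, equivalently no two neighboring empty sites); one studies $PH_{\rm hop}P$ on $P\mathcal H_{N_e}$, where $H_{\rm hop}$ consists of the $t$ and $t'$ terms of $H$; ground states are its lowest-eigenvalue eigenvectors. Total spin operators $S^{(\alpha)}_{\rm tot}=\frac12\sum_x\sum_{\sigma,\tau}c^\dagger_{x,\sigma}(p^{(\alpha)})_{\sigma,\tau}c_{x,\tau}$ (Pauli matrices); total spin $S_{\rm tot}$ means $\sum_\alpha(S^{(\alpha)}_{\rm tot})^2=S_{\rm tot}(S_{\rm tot}+1)$. ''Nondegenerate apart from the trivial $(2S_{\max}+1)$-fold degeneracy'' means the ground-state eigenspace has dimension exactly $2S_{\max}+1$ and all ground states have $S_{\rm tot}=S_{\max}$. *)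

(* Defs.v *)
(* Fermionic Fock space of N_s sites x 2 spins, realized
   concretely on the basis of occupation sets {set 'I_Ns * bool}. *)
From HB Require Import structures.
From mathcomp Require Import all_boot all_order all_algebra.
Set Implicit Arguments. Unset Strict Implicit. Unset Printing Implicit Defensive.
Import Order.TTheory GRing.Theory Num.Theory.
Local Open Scope ring_scope.

(* A mode is (site, spin); spin true = up, false = down.  Site x : 'I_Ns is
   the paper's site x+1. *)
Notation mode Ns := ('I_Ns * bool)%type.
(* Fock basis states: sets of occupied modes. *)
Notation fock Ns := {set mode Ns}.
Notation dimF Ns := #|{: {set mode Ns}}|.

Section Fock.
Variable C : numClosedFieldType.
Variable Ns : nat.

(* fixed total order on modes used for the Jordan-Wigner signs *)
Definition midx (m : mode Ns) : nat := (2 * m.1 + m.2)%N.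

Definition jwsign (T : fock Ns) (m : mode Ns) : C :=
  (-1) ^+ #|[set m' in T | (midx m' < midx m)%N]|.

Definition opmx (f : fock Ns -> fock Ns -> C) : 'M[C]_(dimF Ns) :=
  \matrix_(i, j) f (enum_val i) (enum_val j).

Definition cann (m : mode Ns) : 'M[C]_(dimF Ns) :=
  opmx (fun S T => if (m \in T) && (S == T :\ m) then jwsign T m else 0).

(* creation operator c^dagger_m: the adjoint of c_m (entries are real) *)
Definition ccre (m : mode Ns) : 'M[C]_(dimF Ns) :=
  opmx (fun S T => if (m \notin T) && (S == m |: T) then jwsign T m else 0).

(* c_{k,s} for a 0-based site label k taken modulo Ns (periodic b.c.) *)
Definition cann_at (k : nat) (s : bool) : 'M[C]_(dimF Ns) :=
  \sum_(x : 'I_Ns | val x == (k %% Ns)%N) cann (x, s).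
Definition ccre_at (k : nat) (s : bool) : 'M[C]_(dimF Ns) :=
  \sum_(x : 'I_Ns | val x == (k %% Ns)%N) ccre (x, s).

Definition bond (a b : nat) : 'M[C]_(dimF Ns) :=
  \sum_(s : bool) (ccre_at a s *m cann_at b s + ccre_at b s *m cann_at a s).

(* H_hop : the t and t' terms of H.  Paper's x in 1..Ns is 0-based x-1;
   paper's sites 2j, 2j+2 (j = 1..Ns/2) are 0-based 2j-1, 2j+1, i.e. for
   j' = j-1 in 0..Ns/2-1 they are 2j'+1, 2j'+3. *)
Definition Hhop (t t' : C) : 'M[C]_(dimF Ns) :=
  - t *: (\sum_(x < Ns) bond x x.+1)
  + t' *: (\sum_(j < Ns./2) bond (2 * j).+1 (2 * j).+3).

Definition nocc (S : fock Ns) (x : 'I_Ns) : nat :=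
  ((x, true) \in S) + ((x, false) \in S).

Definition nxt (x : 'I_Ns) : 'I_Ns :=
  Ordinal (ltn_pmod x.+1 (leq_ltn_trans (leq0n x) (ltn_ord x))).

Definition allowed (Ne : nat) (S : fock Ns) : bool :=
  [&& #|S| == Ne,
      [forall x : 'I_Ns, ~~ (((x, true) \in S) && ((x, false) \in S))] &
      (\sum_(x : 'I_Ns) nocc S x * nocc S (nxt x))%N == (2 * Ne - Ns)%N].

Definition Pproj (Ne : nat) : 'M[C]_(dimF Ns) :=
  opmx (fun S T => if (S == T) && allowed Ne T then 1 else 0).

Definition Heff (Ne : nat) (t t' : C) : 'M[C]_(dimF Ns) :=
  Pproj Ne *m Hhop t t' *m Pproj Ne.

Definition is_eigval (Ne : nat) (t t' : C) (E : C) : Prop :=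
  exists v : 'cV[C]_(dimF Ns),
    [/\ v != 0, Pproj Ne *m v = v & Heff Ne t t' *m v = E *: v].

Definition is_ground_energy (Ne : nat) (t t' : C) (E : C) : Prop :=
  is_eigval Ne t t' E /\ forall l, is_eigval Ne t t' l -> E <= l.

Definition ground_state (Ne : nat) (t t' : C) (E : C) (v : 'cV[C]_(dimF Ns))
  : Prop :=
  Pproj Ne *m v = v /\ Heff Ne t t' *m v = E *: v.

(* Pauli matrices p^(a), a = 0,1,2 for x,y,z; index true = up, false = down *)
Definition pauli (a : 'I_3) (s u : bool) : C :=
  match val a with
  | 0%N => if s != u then 1 else 0
  | 1%N => if s == u then 0 else if s then - 'i else 'i
  | _ => if s == u then (if s then 1 else -1) else 0
  end.

Definition Stot (a : 'I_3) : 'M[C]_(dimF Ns) :=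
  2%:R^-1 *: \sum_(x : 'I_Ns) \sum_(s : bool) \sum_(u : bool)
     pauli a s u *: (ccre (x, s) *m cann (x, u)).

Definition Ssq : 'M[C]_(dimF Ns) := \sum_(a < 3) Stot a *m Stot a.

Definition subspace_dim (P : 'cV[C]_(dimF Ns) -> Prop) (d : nat) : Prop :=
  exists B : 'M[C]_(d, dimF Ns),
    row_free B /\ forall v : 'cV[C]_(dimF Ns), P v <-> (v^T <= B)%MS.

End Fock.

(* Main.v *)
(** Let [P] project on the allowed configurations.  Then [P H P] has nonpositive
    entries: a hop between neighbouring sites passes an even number of electrons, also
    around the ring, since their number is odd, and a [t'] hop passes an odd number,
    which turns [+t'] into [-t'].  Its lowest eigenvalue [E] is then negative, so that
    the ground states are exactly the eigenvectors of [P H P] for [E], and with [v]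
    also [|v|] is a ground state.

    The configurations with a given number of up spins are connected by hops.  A
    configuration is a tiling of the ring by electrons and by pairs of a hole and an
    electron.  The [t] hops permute the two kinds of tiles without changing the cyclic
    sequence of spins, which can be rotated by moving the starting point past either
    kind of tile, and a [t'] hop exchanges two neighbouring spins.  Hence a ground
    state that vanishes at one configuration vanishes at all configurations with the
    same number of up spins, so that each of the [Ne + 1] sectors has at most one
    ground state up to a factor.

    The hopping amplitudes do not depend on the spins.  Summing a nonnegative ground
    state over the spins therefore gives a positive function of the occupied sites,
    which is a ground state in every sector; these states are symmetric in the spins
    and have total spin [Ne / 2]. *)
Require Import Defs.
From HB Require Import structures.
From mathcomp Require Import all_boot all_order all_algebra.
From mathcomp Require Import fingroup perm spectral sesquilinear zify ring.
Import Order.TTheory GRing.Theory Num.Theory.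
Local Open Scope ring_scope.

Set Implicit Arguments. Unset Strict Implicit. Unset Printing Implicit Defensive.

(** * Sums, sequences and permutations *)

Lemma card_sum_mem (T : finType) (A : {set T}) : #|A| = (\sum_x (x \in A))%N.
Proof. by rewrite -sum1_card big_mkcond. Qed.

Lemma perm_preimset_inj (T : finType) (p : {perm T}) :
  injective (fun A : {set T} => p @^-1: A).
Proof.
apply: (can_inj (g := fun A : {set T} => p^-1%g @^-1: A)) => A.
by apply/setP => x; rewrite !inE permKV.
Qed.

Lemma sign_card (R : comNzRingType) (I : finType) (P : {pred I}) (Q : pred I) :
  (-1) ^+ #|[set i in P | Q i]| = \prod_(i in P) (-1) ^+ Q i :> R.
Proof.
rewrite -sum1_card expr_sum (eq_bigl (fun i => (i \in P) && Q i)) => [|i]; last first.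
  by rewrite inE.
by rewrite big_mkcondr; apply: eq_bigr => i _; case: (Q i).
Qed.

Lemma sum_dual (R : pzRingType) (I : finType) (a : I -> R) (f : I -> I -> R) l :
  (forall k l, (f k l != 0) = (k == l)) -> \sum_k a k * f k l = a l * f l l.
Proof.
move=> f_dual; rewrite (bigD1 l) //= big1 ?addr0 // => k kl.
by move: (f_dual k l); rewrite (negPf kl) => /negbFE/eqP->; rewrite mulr0.
Qed.

Lemma sum_nth_count (A : Type) (a0 : A) (P : pred A) (s : seq A) k : size s = k ->
  (\sum_(i < k) P (nth a0 s i) = count P s)%N.
Proof.
move=> <-; rewrite -(big_mkord predT (fun i => nat_of_bool (P (nth a0 s i)))).
by rewrite -(big_nth a0 predT (fun a => nat_of_bool (P a))) -sum1_count [RHS]big_mkcond.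
Qed.

Lemma nth_size_cat (A : Type) (a0 a : A) s1 s2 : nth a0 (s1 ++ a :: s2) (size s1) = a.
Proof. by rewrite nth_cat ltnn subnn. Qed.

Lemma nth_cat_cons_neq (A : Type) (a0 a b : A) s1 s2 k : k != size s1 ->
  nth a0 (s1 ++ a :: s2) k = nth a0 (s1 ++ b :: s2) k.
Proof.
move=> k_neq; rewrite !nth_cat; case: ltnP => // k_ge.
by have -> : (k - size s1 = (k - size s1).-1.+1)%N by lia.
Qed.

Lemma perm_cons2C (A : eqType) (x y : A) (s : seq A) :
  perm_eq [:: x, y & s] [:: y, x & s].
Proof. exact: permEl (perm_catCA [:: x] [:: y] s). Qed.

Lemma split_two_at (A : Type) (s : seq A) i : (i.+1 < size s)%N ->
  exists s1 a b s2, s = s1 ++ [:: a, b & s2] /\ size s1 = i.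
Proof.
move=> i_lt; rewrite -[s](cat_take_drop i).
have := size_drop i s; case: (drop _ _) => [|a [|b s2]] /= size_s; [lia | lia |].
by exists (take i s), a, b, s2; rewrite size_takel //; lia.
Qed.

Section AdjacentTranspositions.
Variables (A : eqType) (T : finType) (e : rel T).
Implicit Types (F : seq A -> T) (s : seq A).

Definition adjacent_swaps_connect F s : Prop := forall s1 x y s2,
  perm_eq (s1 ++ [:: x, y & s2]) s ->
  connect e (F (s1 ++ [:: x, y & s2])) (F (s1 ++ [:: y, x & s2])).

Lemma connect_move F x s1 s2 : adjacent_swaps_connect F (x :: s1 ++ s2) ->
  connect e (F (x :: s1 ++ s2)) (F (s1 ++ x :: s2)).
Proof.
elim: s1 F => [|y s1 IH] F swapF; first exact: connect0.
apply: connect_trans (swapF [::] x y _ (perm_refl _)) _.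
apply: (IH (F \o cons y)) => u1 a b u2 u_perm; apply: (swapF (y :: u1)).
by rewrite (permPr (perm_cons2C x y _)) perm_cons.
Qed.

Lemma connect_perm F s s' : adjacent_swaps_connect F s ->
  perm_eq s s' -> connect e (F s) (F s').
Proof.
elim: s s' F => [|x s IH] s' F swapF; first by rewrite perm_sym => /perm_nilP->.
move=> s_perm; move: (s_perm).
have /splitPr[s1 s2] : x \in s' by rewrite -(perm_mem s_perm) mem_head.
rewrite -[x :: s2]cat1s perm_sym perm_catCA perm_cons perm_sym => {}s_perm.
apply: (@connect_trans _ _ (F (x :: s1 ++ s2))).
  apply: (IH _ (F \o cons x)) s_perm => u1 a b u2 u_perm.
  by apply: (swapF (x :: u1)); rewrite /= perm_cons.
apply: connect_move => u1 a b u2 u_perm; apply: swapF.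
by rewrite (permPl u_perm) perm_cons perm_sym.
Qed.

End AdjacentTranspositions.

Lemma perm_eq_bool (s s' : seq bool) :
  perm_eq s s' = (size s == size s') && (count id s == count id s').
Proof.
apply/idP/andP => [ss'|[/eqP ss' /eqP count_ss']].
  by rewrite (perm_size ss') (seq.permP ss').
apply/allP => -[] _ /=; first by rewrite !(eq_count (a2 := id)) ?count_ss' // => -[].
rewrite !(eq_count (a2 := predC id)) //; try by case.
by apply/eqP/(@addnI (count id s)); rewrite {2}count_ss' !count_predC.
Qed.

(** * Lowest eigenvalues of Hermitian matrices *)

Lemma eigenvector_comb (R : comNzRingType) n (I : finType) (A : 'M[R]_n) (l : R)
    (psi : I -> 'cV[R]_n) (a : I -> R) :
  (forall k, A *m psi k = l *: psi k) ->
  A *m (\sum_k a k *: psi k) = l *: (\sum_k a k *: psi k).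
Proof.
move=> psi_eigen; rewrite mulmx_sumr scaler_sumr; apply: eq_bigr => k _.
by rewrite -scalemxAr psi_eigen !scalerA mulrC.
Qed.

Section LowestEigenvalue.
Variables (C : numClosedFieldType) (n : nat).
Implicit Types (A P : 'M[C]_n) (u v : 'cV[C]_n) (E : C).

Local Open Scope sesquilinear_scope.

Definition sqnorm u : C := \sum_i `|u i 0| ^+ 2.

Definition qform A u : C := (u^t* *m A *m u) 0 0.

Definition lowest_eigenvalue A E : Prop :=
  (exists2 v : 'cV_n, v != 0 & A *m v = E *: v) /\
  forall u : 'cV_n, E * sqnorm u <= qform A u ?= iff (A *m u == E *: u).

Lemma sqnorm_gt0 u : (0 < sqnorm u) = (u != 0).
Proof.
rewrite lt0r sumr_ge0 ?andbT => [|i _]; last by rewrite exprn_ge0.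
congr (~~ _); apply/eqP/eqP => [u0|->]; last first.
  by rewrite /sqnorm big1 // => i _; rewrite mxE normr0 expr0n.
apply/matrixP => i j; rewrite ord1 mxE; apply/eqP.
have /(_ i isT)/eqP := psumr_eq0P (fun k _ => exprn_ge0 2 (normr_ge0 (u k 0))) u0.
by rewrite expf_eq0 normr_eq0.
Qed.

Lemma qformE A u : qform A u = \sum_i \sum_j A i j * ((u i 0)^* * u j 0).
Proof.
rewrite /qform -mulmxA mxE; apply: eq_bigr => i _; rewrite [X in _ * X]mxE mulr_sumr.
by apply: eq_bigr => j _; rewrite !mxE mulrCA.
Qed.

Lemma qform_diag (d : 'rV[C]_n) u : qform (diag_mx d) u = \sum_i d 0 i * `|u i 0| ^+ 2.
Proof.
rewrite /qform -mulmxA mul_diag_mx mxE; apply: eq_bigr => i _.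
by rewrite !mxE mulrCA normCKC.
Qed.

Lemma qform1 u : qform 1%:M u = sqnorm u.
Proof.
rewrite -diag_const_mx qform_diag.
by under eq_bigr do rewrite mxE mul1r.
Qed.

Lemma qform_conj P A u : qform (P^t* *m A *m P) u = qform A (P *m u).
Proof. by rewrite /qform trmx_mul map_mxM !mulmxA. Qed.

Lemma qform_eigenvector A u E : A *m u = E *: u -> qform A u = E * sqnorm u.
Proof. by move=> Au; rewrite -qform1 /qform -mulmxA Au -scalemxAr mxE mulmx1. Qed.

Lemma qform_real A u : A \is hermsymmx -> qform A u \is Num.real.
Proof.
move=> /is_hermitianmxP; rewrite expr0 scale1r => A_hermsym; apply/CrealP.
have -> : (qform A u)^* = ((u^t* *m A *m u)^t*) 0 0 by rewrite [RHS]mxE [_^T _ _]mxE.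
by rewrite !(trmx_mul, map_mxM) trmxCK -A_hermsym mulmxA.
Qed.

Lemma lowest_eigenvalue_diag (d : 'rV[C]_n) : (0 < n)%N -> d \is a mxOver Num.real ->
  exists E, lowest_eigenvalue (diag_mx d) E.
Proof.
move=> n_gt0 /mxOverP d_real.
have [i0 _ d_min] := @real_arg_minP C _ (Ordinal n_gt0) predT (d 0) isT
  (fun i _ => d_real 0 i).
exists (d 0 i0); split=> [|u].
  exists (delta_mx i0 0).
    by apply/eqP => /matrixP /(_ i0 0)/eqP; rewrite !mxE !eqxx oner_eq0.
  apply/matrixP => i j; rewrite mul_diag_mx !mxE.
  by case: eqP => [->|_]; rewrite ?mulr0.
have -> : (diag_mx d *m u == d 0 i0 *: u) = [forall i, (d 0 i == d 0 i0) || (u i 0 == 0)].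
  apply/eqP/forallP => [du i|du].
    have /matrixP/(_ i 0)/eqP := du; rewrite mul_diag_mx !mxE -subr_eq0 -mulrBl.
    by rewrite mulf_eq0 subr_eq0.
  apply/matrixP => i j; rewrite ord1 mul_diag_mx !mxE.
  by have /orP[/eqP->|/eqP->] := du i; rewrite ?mulr0.
rewrite qform_diag mulr_sumr; apply: leif_sum => i _; split.
  by rewrite ler_wpM2r ?exprn_ge0 ?d_min.
by rewrite -subr_eq0 -mulrBl mulf_eq0 subr_eq0 eq_sym expf_eq0 normr_eq0.
Qed.

Lemma lowest_eigenvalue_unitary_conj P A E : P \is unitarymx ->
  lowest_eigenvalue A E -> lowest_eigenvalue (invmx P *m A *m P) E.
Proof.
move=> P_unitary [[v v_neq0 Av] E_rayleigh]; have P_unit := unitarymx_unit P_unitary.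
have eigE u : (invmx P *m A *m P *m u == E *: u) = (A *m (P *m u) == E *: (P *m u)).
  rewrite -(inj_eq (can_inj (mulKmx P_unit))) -scalemxAr.
  by rewrite -!mulmxA mulKVmx.
split=> [|u].
  exists (invmx P *m v); last by apply/eqP; rewrite eigE mulKVmx // Av.
  by apply: contraNneq v_neq0 => Pv; rewrite -[v](mulKVmx P_unit) Pv mulmx0.
rewrite eigE {1}invmx_unitary // qform_conj.
suff -> : sqnorm u = sqnorm (P *m u) by exact: E_rayleigh.
by rewrite -!qform1 -qform_conj mulmx1 -invmx_unitary // mulVmx.
Qed.

Lemma hermitian_lowest_eigenvalue A : (0 < n)%N -> A \is hermsymmx ->
  exists E, lowest_eigenvalue A E.
Proof.
move=> n_gt0 A_hermsym; have [E E_low] :=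
  lowest_eigenvalue_diag n_gt0 (hermitian_spectral_diag_real A_hermsym).
exists E; rewrite (orthomx_spectralP (hermitian_normalmx A_hermsym)).
exact: lowest_eigenvalue_unitary_conj (spectral_unitarymx A) E_low.
Qed.

Lemma lowest_eigenvalue_le A E l v :
  lowest_eigenvalue A E -> v != 0 -> A *m v = l *: v -> E <= l.
Proof.
move=> [_ E_rayleigh] v_neq0 /qform_eigenvector Av.
by have := (E_rayleigh v).1; rewrite Av ler_pM2r // sqnorm_gt0.
Qed.

End LowestEigenvalue.

Section NonpositiveEntries.
Variables (C : numClosedFieldType) (n : nat) (A : 'M[C]_n).
Hypotheses (A_herm : A \is hermsymmx) (A_le0 : forall i j, A i j <= 0).
Implicit Types (u v : 'cV[C]_n) (i j : 'I_n).

Local Notation nrm u := (map_mx Num.norm u).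

Lemma sqnorm_normr u : sqnorm (nrm u) = sqnorm u.
Proof. by apply: eq_bigr => i _; rewrite mxE normr_id. Qed.

Lemma qform_normr_le u : qform A (nrm u) <= qform A u.
Proof.
have -> : qform A (nrm u) = - \sum_i \sum_j `|A i j * ((u i 0)^* * u j 0)|.
  rewrite qformE -sumrN; apply: eq_bigr => i _; rewrite -sumrN; apply: eq_bigr => j _.
  rewrite !mxE !normrM norm_conjC (conj_Creal (normr_real _)) ler0_norm ?A_le0 //.
  by rewrite mulNr opprK.
apply: le_trans (real_lerNnormlW (qform_real u A_herm) (lexx _)).
rewrite lerN2 qformE; apply: le_trans (ler_norm_sum _ _ _) _.
by apply: ler_sum => i _; exact: ler_norm_sum.
Qed.

Variable E : C.
Hypothesis E_low : lowest_eigenvalue A E.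

Lemma lowest_eigenvalue_lt0 i j : A i j != 0 -> E < 0.
Proof.
move=> Aij; pose v : 'cV[C]_n := const_mx 1.
have v_gt0 : 0 < sqnorm v.
  by rewrite sqnorm_gt0; apply/eqP => /matrixP/(_ i 0)/eqP; rewrite !mxE oner_eq0.
rewrite -(pmulr_llt0 _ v_gt0); apply: le_lt_trans (E_low.2 v).1 _.
rewrite qformE; under eq_bigr do under eq_bigr do rewrite !mxE conjC1 !mulr1.
rewrite (bigD1 i) //= (bigD1 j) //= -addrA ltr_nwDl ?lt_neqAle ?Aij ?A_le0 //.
by rewrite -[leRHS]addr0 lerD ?sumr_le0 // => k _; exact: sumr_le0.
Qed.

Lemma lowest_eigenvector_normr u : A *m u = E *: u -> A *m nrm u = E *: nrm u.
Proof.
move=> /qform_eigenvector Au; apply/eqP; rewrite -(ge_leif (E_low.2 _)).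
by rewrite sqnorm_normr -Au qform_normr_le.
Qed.

Lemma lowest_eigenvector_eq0_step u i j : A *m u = E *: u -> A i j != 0 ->
  u i 0 = 0 -> u j 0 = 0.
Proof.
move=> /lowest_eigenvector_normr/matrixP/(_ i 0) Au Aij ui0.
have term_ge0 k : true -> 0 <= - (A i k * `|u k 0|).
  by rewrite -mulNr mulr_ge0 // oppr_ge0.
have sum0 : \sum_k - (A i k * `|u k 0|) = 0.
  move: Au; rewrite !mxE ui0 normr0 mulr0 sumrN.
  by under eq_bigr do rewrite mxE; move->; rewrite oppr0.
have /eqP := psumr_eq0P term_ge0 sum0 (i := j) isT.
by rewrite oppr_eq0 mulf_eq0 (negPf Aij) normr_eq0 => /eqP.
Qed.

Lemma lowest_eigenvector_eq0_connect u i j : A *m u = E *: u ->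
  connect [rel k l | A k l != 0] i j -> u i 0 = 0 -> u j 0 = 0.
Proof.
move=> Au /connectP[p pth ->].
elim: p i pth => //= k p IH i /andP[Aik pth] ui0.
by apply: IH pth _; exact: lowest_eigenvector_eq0_step Au Aik ui0.
Qed.

Lemma lowest_eigenspace_span (I : finType) (psi : I -> 'cV[C]_n) (pt : I -> 'I_n) :
  (forall k, A *m psi k = E *: psi k) ->
  (forall k l, (psi k (pt l) 0 != 0) = (k == l)) ->
  (forall u i, A *m u = E *: u -> u i 0 != 0 ->
     exists k, connect [rel k l | A k l != 0] (pt k) i) ->
  forall u, A *m u = E *: u -> exists a : I -> C, u = \sum_k a k *: psi k.
Proof.
move=> psi_eigen psi_pt supp u Au; pose a k := u (pt k) 0 / psi k (pt k) 0.
(* [w] is an eigenvector that vanishes at some point of every component. *)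
exists a; apply/eqP; rewrite -subr_eq0; set w := u - _.
have Aw : A *m w = E *: w by rewrite mulmxBr scalerBr Au (eigenvector_comb a psi_eigen).
have w_pt l : w (pt l) 0 = 0.
  rewrite !mxE summxE; under eq_bigr do rewrite mxE.
  by rewrite (sum_dual a l psi_pt) divfK ?psi_pt // subrr.
apply/eqP/matrixP => i j; rewrite ord1 [RHS]mxE; apply/eqP/negP => /negP wi.
have [k /(lowest_eigenvector_eq0_connect Aw)/(_ (w_pt k)) wi0] := supp w i Aw wi.
by rewrite wi0 eqxx in wi.
Qed.

End NonpositiveEntries.

(** * Configurations of electrons *)

Section Configurations.
Variable Ns : nat.
Implicit Types (S T : fock Ns) (X : {set 'I_Ns}) (x y z : 'I_Ns) (p : {perm 'I_Ns}).

Definition single_occ S : bool :=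
  [forall x, ~~ (((x, true) \in S) && ((x, false) \in S))].

Definition occupied S : {set 'I_Ns} := [set x | ((x, true) \in S) || ((x, false) \in S)].

Definition num_up S : nat := #|[set x | (x, true) \in S]|.

Definition permute_sites p S : fock Ns := [set m | (p m.1, m.2) \in S].

Lemma in_occupied S x :
  (x \in occupied S) = ((x, true) \in S) || ((x, false) \in S).
Proof. exact: in_set. Qed.

Lemma mem_occupied S x s : (x, s) \in S -> x \in occupied S.
Proof. by rewrite in_occupied; case: s => ->; rewrite ?orbT. Qed.

Lemma occupiedP S x : reflect (exists s, (x, s) \in S) (x \in occupied S).
Proof.
apply: (iffP idP) => [|[s]]; last exact: mem_occupied.
by rewrite in_occupied => /orP[]; [exists true | exists false].
Qed.

Lemma single_occ_spin S x s u : single_occ S -> (x, u) \in S -> ((x, s) \in S) = (s == u).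
Proof.
by move=> /forallP/(_ x); case: s; case: u; do 2!case: (_ \in S).
Qed.

Lemma noccE S x : single_occ S -> nocc S x = (x \in occupied S).
Proof. by move=> /forallP/(_ x); rewrite /nocc inE; do 2!case: (_ \in S). Qed.

Lemma card_modes_at S (P : pred 'I_Ns) : single_occ S ->
  #|[set m in S | P m.1]| = #|[set x in occupied S | P x]|.
Proof.
move=> S_single; rewrite -(@card_in_imset _ _ fst); last first.
  move=> [x s] [y u]; rewrite !inE /= => /andP[xS _] /andP[yS _] xy; subst y.
  by move: xS; rewrite (single_occ_spin _ S_single yS) => /eqP->.
apply: eq_card => x; apply/imsetP/idP => [[[y s]]|].
  by rewrite !inE /= => /andP[/mem_occupied] + Py ->; rewrite inE => ->.
by rewrite inE => /andP[/occupiedP[s xS] Px]; exists (x, s); rewrite // inE xS.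
Qed.

Lemma card_occupied S : single_occ S -> #|S| = #|occupied S|.
Proof.
move=> /(card_modes_at predT); rewrite (_ : [set m in S | _] = S) => [->|].
  by apply: eq_card => x; rewrite inE andbT.
by apply/setP => m; rewrite inE andbT.
Qed.

Lemma permute_sitesK p : cancel (permute_sites p) (permute_sites p^-1).
Proof. by move=> S; apply/setP => -[x s]; rewrite !inE /= permKV. Qed.

Lemma permute_tpermK x y : involutive (permute_sites (tperm x y)).
Proof. by move=> S; rewrite -{1}[tperm x y]tpermV permute_sitesK. Qed.

Lemma single_occ_permute p S : single_occ (permute_sites p S) = single_occ S.
Proof.
apply/forallP/forallP => S_single x; last by rewrite !inE; exact: S_single.
by have := S_single (p^-1 x)%g; rewrite !inE /= permKV.
Qed.

Lemma mem_occupied_permute p S x :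
  (x \in occupied (permute_sites p S)) = (p x \in occupied S).
Proof. by rewrite !inE. Qed.

Lemma occupied_permute p S : occupied (permute_sites p S) = p @^-1: occupied S.
Proof. by apply/setP => x; rewrite !inE. Qed.

Lemma num_up_permute p S : num_up (permute_sites p S) = num_up S.
Proof.
rewrite /num_up -[RHS](card_preimset _ (@perm_inj _ p)).
by apply: eq_card => x; rewrite !inE.
Qed.

Lemma num_up_sum S : num_up S = (\sum_x ((x, true) \in S))%N.
Proof. by rewrite /num_up card_sum_mem; apply: eq_bigr => x _; rewrite inE. Qed.

Lemma num_up_le_card S : single_occ S -> (num_up S <= #|S|)%N.
Proof.
move=> S_single; rewrite card_occupied //; apply/subset_leq_card/subsetP => x.
by rewrite inE; exact: mem_occupied.
Qed.

Lemma exists_spins X k : (k <= #|X|)%N ->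
  exists S, [/\ single_occ S, occupied S = X & num_up S = k].
Proof.
rewrite -bin_gt0 -cards_draws => /card_gt0P[U]; rewrite inE => /andP[/subsetP UX /eqP <-].
pose S : fock Ns := [set m | (m.1 \in X) && (m.2 == (m.1 \in U))].
have inS x s : ((x, s) \in S) = (x \in X) && (s == (x \in U)) by rewrite inE.
exists S; split.
- by apply/forallP => x; rewrite !inS; case: (x \in U); rewrite /= ?andbF.
- by apply/setP => x; rewrite inE !inS -andb_orr; case: (x \in U); rewrite /= ?andbT.
by apply: eq_card => x; rewrite inE inS eq_sym eqb_id; apply/andb_idl/UX.
Qed.

Definition packed (Ne : nat) X : bool :=
  (#|X| == Ne) && [forall x, (x \in X) || (nxt x \in X)].

Lemma nxt_inj : injective (@nxt Ns).
Proof.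
move=> x y /(congr1 val) /= /eqP.
by rewrite -addn1 -(addn1 y) eqn_modDr !modn_small // => /eqP/val_inj.
Qed.

Lemma count_occupied_bonds X :
  (\sum_x (x \in X) * (nxt x \in X) + Ns
     = 2 * #|X| + #|[set x | (x \notin X) && (nxt x \notin X)]|)%N.
Proof.
have card_nxt : #|X| = (\sum_x (nxt x \in X))%N.
  by rewrite card_sum_mem (reindex_inj nxt_inj).
have -> : (2 * #|X| = \sum_x ((x \in X) + (nxt x \in X)))%N.
  by rewrite big_split /= -card_nxt -card_sum_mem mul2n addnn.
rewrite card_sum_mem -[X in (_ + X)%N = _](card_ord Ns) -sum1_card.
rewrite -!big_split; apply: eq_bigr => x _ /=.
by rewrite inE; do 2!case: (_ \in X).
Qed.

Lemma allowedE Ne S : (Ns <= 2 * Ne)%N ->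
  allowed Ne S = single_occ S && packed Ne (occupied S).
Proof.
move=> Ns_le; rewrite /allowed andbCA -/(single_occ S).
have [S_single|//] /= := boolP (single_occ S).
rewrite card_occupied // /packed; case: eqP => //= cardX.
under eq_bigr do rewrite !noccE //.
move: (occupied S) cardX => X cardX.
have -> : (\sum_x (x \in X) * (nxt x \in X)
    = 2 * Ne + #|[set x | (x \notin X) && (nxt x \notin X)]| - Ns)%N.
  by rewrite -cardX -count_occupied_bonds addnK.
set holes := [set x | _].
transitivity (#|holes| == 0%N); first lia.
rewrite cards_eq0; apply/eqP/forallP => [/setP no_holes x|no_holes].
  by have := no_holes x; rewrite !inE -negb_or => /negbFE.
by apply/setP => x; rewrite !inE -negb_or no_holes.
Qed.

Lemma allowed_single_occ Ne S : allowed Ne S -> single_occ S.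
Proof. by case/and3P. Qed.

Lemma exists_allowed_spins Ne S k : (Ns <= 2 * Ne)%N -> allowed Ne S -> (k <= Ne)%N ->
  exists T, [/\ allowed Ne T, occupied T = occupied S & num_up T = k].
Proof.
move=> Ns_le; rewrite allowedE // => /andP[_ S_packed] k_le.
have /andP[/eqP cardS _] := S_packed.
have [|T [T_single occ_T num_up_T]] := @exists_spins (occupied S) k.
  by rewrite cardS.
by exists T; rewrite allowedE // T_single occ_T.
Qed.

Lemma num_up_allowed Ne S : allowed Ne S -> (num_up S <= Ne)%N.
Proof. by move=> /and3P[/eqP<- S_single _]; exact: num_up_le_card. Qed.

End Configurations.

(** * Operators on the Fock space *)

Section FockOperators.
Variables (C : numClosedFieldType) (Ns : nat).
Implicit Types (S T R : fock Ns) (v w : 'cV[C]_(dimF Ns)).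
Implicit Types F G : fock Ns -> fock Ns -> C.

Definition amplitude v S : C := v (enum_rank S) 0.

Definition fock_vec (f : fock Ns -> C) : 'cV[C]_(dimF Ns) := \col_i f (enum_val i).

Lemma amplitude_fock_vec f : amplitude (fock_vec f) =1 f.
Proof. by move=> S; rewrite /amplitude mxE enum_rankK. Qed.

Lemma amplitude_inj v w : amplitude v =1 amplitude w -> v = w.
Proof.
move=> vw; apply/matrixP => i j; rewrite ord1.
by have := vw (enum_val i); rewrite /amplitude enum_valK.
Qed.

Lemma amplitude_neq0 v : v != 0 -> exists S, amplitude v S != 0.
Proof.
move=> v_neq0; apply/existsP; apply: contraNT v_neq0; rewrite negb_exists => /forallP v0.
by apply/eqP/amplitude_inj => S; rewrite [RHS]mxE; apply/eqP; rewrite -[_ == _]negbK v0.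
Qed.

Lemma amplitudeZ a v S : amplitude (a *: v) S = a * amplitude v S.
Proof. by rewrite /amplitude mxE. Qed.

Lemma amplitude_sum (I : finType) (v_ : I -> 'cV[C]_(dimF Ns)) S :
  amplitude (\sum_i v_ i) S = \sum_i amplitude (v_ i) S.
Proof. by rewrite /amplitude summxE. Qed.

Lemma sum_enum_val (f : fock Ns -> C) : \sum_(i < dimF Ns) f (enum_val i) = \sum_S f S.
Proof. by rewrite -big_enum_val. Qed.

Lemma opmx_rank F S T : opmx F (enum_rank S) (enum_rank T) = F S T.
Proof. by rewrite mxE !enum_rankK. Qed.

Lemma amplitude_opmx F v S : amplitude (opmx F *m v) S = \sum_T F S T * amplitude v T.
Proof.
rewrite /amplitude mxE -sum_enum_val; apply: eq_bigr => i _.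
by rewrite mxE enum_rankK enum_valK.
Qed.

Lemma eq_opmx F G : F =2 G -> opmx F = opmx G.
Proof. by move=> FG; apply/matrixP => i j; rewrite !mxE. Qed.

Lemma opmxM F G : opmx F *m opmx G = opmx (fun S T => \sum_R F S R * G R T).
Proof.
apply/matrixP => i j; rewrite !mxE -sum_enum_val.
by apply: eq_bigr => k _; rewrite !mxE.
Qed.

Lemma opmxD F G : opmx F + opmx G = opmx (fun S T => F S T + G S T).
Proof. by apply/matrixP => i j; rewrite !mxE. Qed.

Lemma opmxZ a F : a *: opmx F = opmx (fun S T => a * F S T).
Proof. by apply/matrixP => i j; rewrite !mxE. Qed.

Lemma opmx_sum (I : finType) (F_ : I -> fock Ns -> fock Ns -> C) :
  \sum_i opmx (F_ i) = opmx (fun S T => \sum_i F_ i S T).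
Proof.
by apply/matrixP => i j; rewrite summxE mxE; apply: eq_bigr => k _; rewrite mxE.
Qed.

Definition spin_sym_vec Ne (G : {set 'I_Ns} -> nat -> C) : 'cV[C]_(dimF Ns) :=
  fock_vec (fun S => if allowed Ne S then G (occupied S) (num_up S) else 0).

Lemma amplitude_spin_sym_vec Ne (G : {set 'I_Ns} -> nat -> C) S :
  amplitude (spin_sym_vec Ne G) S = if allowed Ne S then G (occupied S) (num_up S) else 0.
Proof. exact: amplitude_fock_vec. Qed.

Lemma spin_sym_vecZ Ne a (G : {set 'I_Ns} -> nat -> C) :
  a *: spin_sym_vec Ne G = spin_sym_vec Ne (fun X k => a * G X k).
Proof.
apply: amplitude_inj => S; rewrite amplitudeZ !amplitude_spin_sym_vec.
by case: ifP; rewrite ?mulr0.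
Qed.

Lemma PprojE Ne : Pproj C Ns Ne = opmx (fun S T => ((S == T) && allowed Ne T)%:R).
Proof. by apply: eq_opmx => S T; case: ifP. Qed.

Lemma Pproj_idem Ne : Pproj C Ns Ne *m Pproj C Ns Ne = Pproj C Ns Ne.
Proof.
rewrite PprojE opmxM; apply: eq_opmx => S T.
rewrite (bigD1 T) //= big1 ?addr0 => [|R /negPf->]; last by rewrite mulr0.
by rewrite eqxx; case: allowed; rewrite ?andbF ?mulr0 ?mulr1.
Qed.

Lemma Pproj_sandwich Ne F : Pproj C Ns Ne *m opmx F *m Pproj C Ns Ne
  = opmx (fun S T => if allowed Ne S && allowed Ne T then F S T else 0).
Proof.
rewrite PprojE !opmxM; apply: eq_opmx => S T.
rewrite (bigD1 T) //= [X in _ + X]big1 ?addr0 => [|R /negPf->]; last by rewrite mulr0.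
rewrite eqxx (bigD1 S) //= [X in _ + X]big1 ?addr0 => [|R]; last first.
  by rewrite eq_sym => /negPf->; rewrite mul0r.
by rewrite eqxx; do 2!case: allowed; rewrite /= ?mul1r ?mulr1 ?mul0r ?mulr0.
Qed.

Lemma subspace_dim_basis (P : 'cV[C]_(dimF Ns) -> Prop) d
    (psi : 'I_d -> 'cV[C]_(dimF Ns)) (pt : 'I_d -> fock Ns) :
  (forall k l, (amplitude (psi k) (pt l) != 0) = (k == l)) ->
  (forall v, P v <-> exists a : 'I_d -> C, v = \sum_k a k *: psi k) ->
  subspace_dim P d.
Proof.
move=> psi_pt P_span; pose B : 'M_(d, _) := \matrix_k (psi k)^T.
have mulB (u : 'rV_d) : (u *m B)^T = \sum_k u 0 k *: psi k.
  rewrite mulmx_sum_row linear_sum; apply: eq_bigr => k _.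
  by rewrite rowK linearZ /= trmxK.
exists B; split.
  apply/inj_row_free => u uB0; apply/rowP => l; rewrite mxE; apply/eqP.
  have /(congr1 (amplitude^~ (pt l))) := mulB u.
  rewrite uB0 trmx0 {1}/amplitude mxE amplitude_sum.
  under eq_bigr do rewrite amplitudeZ; rewrite (sum_dual (u 0) l psi_pt).
  by move/esym/eqP; rewrite mulf_eq0 -[X in _ || X]negbK psi_pt eqxx orbF.
move=> v; rewrite P_span; split=> [[a ->]|/submxP[u /(congr1 trmx)]].
  apply/submxP; exists (\row_k a k); apply: trmx_inj; rewrite trmxK mulB.
  by apply: eq_bigr => k _; rewrite mxE.
by rewrite trmxK mulB => ->; exists (u 0).
Qed.

Definition hop_elt (p q : mode Ns) S T : C :=
  if [&& q \in T, p \notin T :\ q & S == p |: (T :\ q)]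
  then jwsign C T q * jwsign C (T :\ q) p else 0.

Lemma ccre_cann p q : ccre C p *m cann C q = opmx (hop_elt p q).
Proof.
rewrite opmxM; apply: eq_opmx => S T; rewrite /hop_elt.
rewrite (bigD1 (T :\ q)) //= big1 ?addr0 => [|R /negPf->]; last first.
  by rewrite andbF mulr0.
by rewrite eqxx andbT; case: (q \in T); case: ifP; rewrite ?mulr0 ?mul0r // mulrC.
Qed.

Lemma jwsign_move T p q : q \in T -> jwsign C T q * jwsign C (T :\ q) p
  = (-1) ^+ #|[set m in T :\ q | (midx m < midx q)%N (+) (midx m < midx p)%N]|.
Proof.
move=> qT; have -> : jwsign C T q = jwsign C (T :\ q) q.
  congr (_ ^+ _); apply: eq_card => m; rewrite !inE.
  by case: eqVneq => [->|]; rewrite ?ltnn ?andbF.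
rewrite /jwsign !sign_card -big_split; apply: eq_bigr => m _ /=.
by rewrite signr_addb.
Qed.

Definition between (x y z : 'I_Ns) : bool := (x < z < y)%N || (y < z < x)%N.

Lemma between_sym x y : between x y =1 between y x.
Proof. by move=> z; rewrite /between orbC. Qed.

Section HopElement.
Variables (S T : fock Ns) (x y : 'I_Ns).
Hypotheses (xy : x != y) (S_single : single_occ S) (T_single : single_occ T).

Lemma jwsign_site_move s : (y, s) \in T -> x \notin occupied T ->
  jwsign C T (y, s) * jwsign C (T :\ (y, s)) (x, s)
    = (-1) ^+ #|[set z in occupied T | between x y z]|.
Proof.
move=> yT xT; rewrite jwsign_move // -card_modes_at //; congr (_ ^+ _).
apply: eq_card => -[z u]; rewrite !inE /=.
have [zT|] := boolP ((z, u) \in T); last by rewrite andbF.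
rewrite andbT; have zx : z != x by apply: contraNneq xT => <-; exact: mem_occupied zT.
have [zy|zy] := eqVneq z y.
  subst z; have := single_occ_spin u T_single yT; rewrite zT => /esym/eqP->.
  by rewrite /between eqxx !ltnn !andbF.
rewrite xpair_eqE (negPf zy) /=; move: zx zy xy; rewrite -!val_eqE /midx /between /=.
by case: (s); case: (u) => /=; lia.
Qed.

Lemma move_eq_permute s : (y, s) \in T -> x \notin occupied T ->
  (x, s) |: (T :\ (y, s)) = permute_sites (tperm x y) T.
Proof.
move=> yT xT; have xN u : ((x, u) \in T) = false.
  by apply: contraNF xT; exact: mem_occupied.
apply/setP => -[z u]; rewrite !inE !xpair_eqE /=.
case: tpermP => [->|->|/eqP/negPf-> /eqP/negPf->] //.
  by rewrite eqxx xN andbF orbF (single_occ_spin u T_single yT).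
by rewrite eqxx xN (eq_sym y) (negPf xy) /= (single_occ_spin u T_single yT) andNb.
Qed.

Lemma hop_elt_site s : hop_elt (x, s) (y, s) S T =
  if [&& (y, s) \in T, x \notin occupied T & S == permute_sites (tperm x y) T]
  then (-1) ^+ #|[set z in occupied T | between x y z]| else 0.
Proof.
rewrite /hop_elt; have [yT|//] := boolP ((y, s) \in T).
have [/occupiedP[u xT]|xT] := boolP (x \in occupied T); last first.
  rewrite in_setD1 (negPf (contra (@mem_occupied _ _ _ s) xT)) andbF /=.
  by rewrite move_eq_permute //; case: eqP => // _; rewrite jwsign_site_move.
case: ifP => // /and3P[_ + /eqP S_def].
have xuS : (x, u) \in S by rewrite S_def !inE !xpair_eqE (negPf xy) xT orbT.
have := single_occ_spin s S_single xuS; rewrite S_def !inE eqxx !xpair_eqE (negPf xy) /=.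
by move=> /esym/eqP->; rewrite xT.
Qed.

End HopElement.

Definition hops (x y : 'I_Ns) S T : bool :=
  ((x \in occupied T) != (y \in occupied T)) && (S == permute_sites (tperm x y) T).

Lemma hops_sym x y S T : hops x y S T = hops x y T S.
Proof.
suff imp A B : hops x y A B -> hops x y B A by apply/idP/idP; exact: imp.
move=> /andP[xyB /eqP->]; rewrite /hops permute_tpermK eqxx andbT.
by rewrite !mem_occupied_permute tpermL tpermR eq_sym.
Qed.

Definition bond_elt (x y : 'I_Ns) S T : C :=
  \sum_(s : bool) (hop_elt (x, s) (y, s) S T + hop_elt (y, s) (x, s) S T).

Lemma bond_eltE x y S T : x != y -> single_occ S -> single_occ T ->
  bond_elt x y S T = (hops x y S T)%:R * (-1) ^+ #|[set z in occupied T | between x y z]|.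
Proof.
move=> xy S_single T_single; have yx : y != x by rewrite eq_sym.
rewrite /bond_elt big_bool /= !hop_elt_site // (tpermC y x).
have -> : [set z in occupied T | between y x z] = [set z in occupied T | between x y z].
  by apply/setP => z; rewrite !inE between_sym.
have := forallP T_single x; have := forallP T_single y; rewrite /hops !inE.
case: (S == _); case: ((x, true) \in T); case: ((x, false) \in T);
  case: ((y, true) \in T); case: ((y, false) \in T) => //= _ _;
  by rewrite ?addr0 ?add0r ?mul0r ?mul1r.
Qed.

End FockOperators.

(* A bond across the end of the labelling has almost all sites [between] its ends,
   but few [outside]. *)
Definition outside Ns (x y z : 'I_Ns) : bool := (z < minn x y)%N || (maxn x y < z)%N.

Lemma odd_between_outside Ns (X : {set 'I_Ns}) x y :
  odd #|X| -> (x \in X) != (y \in X) ->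
  odd #|[set z in X | between x y z]| = odd #|[set z in X | outside x y z]|.
Proof.
move=> oddX ends_neq; have xy : x != y by apply: contraNneq ends_neq => ->.
have outside_def :
    [set z in X | outside x y z] = (X :\: [set z | between x y z]) :\ x :\ y.
  apply/setP => z; rewrite !inE; case: (z \in X); rewrite ?andbF //= !andbT.
  by move: xy; rewrite /outside /between -!val_eqE /=; lia.
have card_ends : ((x \in X) + (y \in X) = 1)%N by move: ends_neq; do 2!case: (_ \in X).
move: oddX; rewrite -(cardsID [set z | between x y z] X).
rewrite (cardsD1 x (_ :\: _)) (cardsD1 y (_ :\ x)) -outside_def.
rewrite !inE /between !ltnn !andbF eq_sym xy /= (addnA (_ \in _)) card_ends -setIdE.
by rewrite !oddD /=; do 2!case: (odd _).
Qed.

(** * Total spin *)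

Section TotalSpin.
Variables (C : numClosedFieldType) (Ns Ne : nat).
Hypothesis Ns_le : (Ns <= 2 * Ne)%N.
Implicit Types (S T : fock Ns) (x : 'I_Ns) (s u : bool) (G : {set 'I_Ns} -> nat -> C).

Definition set_spin x s u T : fock Ns := (x, s) |: (T :\ (x, u)).

Section SetSpin.
Variables (T : fock Ns) (x : 'I_Ns) (s u : bool).
Hypotheses (T_single : single_occ T) (xT : (x, u) \in T).

Lemma mem_set_spin z r :
  ((z, r) \in set_spin x s u T) = if z == x then r == s else (z, r) \in T.
Proof.
rewrite !inE !xpair_eqE; case: eqP => [->|] //=.
by rewrite (single_occ_spin r T_single xT) andNb orbF.
Qed.

Lemma set_spinK : set_spin x u s (set_spin x s u T) = T.
Proof.
rewrite /set_spin setU1K ?setD1K // !inE xpair_eqE eqxx.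
by rewrite (single_occ_spin s T_single xT) andNb.
Qed.

Lemma occupied_set_spin : occupied (set_spin x s u T) = occupied T.
Proof.
apply/setP => z; rewrite !in_occupied !mem_set_spin; case: eqP => // ->.
by rewrite -in_occupied (mem_occupied xT); case: (s).
Qed.

Lemma single_occ_set_spin : single_occ (set_spin x s u T).
Proof.
apply/forallP => z; rewrite !mem_set_spin; case: eqP => _; first by case: (s).
exact: (forallP T_single).
Qed.

Lemma num_up_set_spin : (num_up (set_spin x s u T) + u = num_up T + s)%N.
Proof.
rewrite !num_up_sum (bigD1 x) //= [in RHS](bigD1 x) //= mem_set_spin eqxx.
rewrite (single_occ_spin true T_single xT).
rewrite (eq_bigr (fun z => (z, true) \in T : nat)) => [|z /negPf zx]; last first.
  by rewrite mem_set_spin zx.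
by case: (s); case: (u); rewrite /= ?addn0 ?add0n // addnC.
Qed.

Lemma hop_elt_spin S : hop_elt C (x, s) (x, u) S T = (S == set_spin x s u T)%:R.
Proof.
rewrite /hop_elt xT -/(set_spin x s u T) jwsign_move // !inE xpair_eqE eqxx.
rewrite (single_occ_spin s T_single xT) andNb /=; case: eqP => // _.
rewrite eq_card0 // => -[z r]; rewrite !inE xpair_eqE.
have [->|zx] /= := eqVneq z x; first by rewrite (single_occ_spin r T_single xT) andNb.
apply/negbTE; rewrite negb_and; apply/orP; right.
by move: zx; rewrite -val_eqE /midx /=; case: (s); case: (u); case: (r) => /=; lia.
Qed.

End SetSpin.

Lemma allowed_set_spin T x s u : allowed Ne T -> (x, u) \in T ->
  allowed Ne (set_spin x s u T).
Proof.
rewrite !allowedE // => /andP[T_single T_packed] xT.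
by rewrite single_occ_set_spin // occupied_set_spin.
Qed.

Lemma amplitude_spin_hop G S x s u :
  amplitude (ccre C (x, s) *m cann C (x, u) *m spin_sym_vec Ne G) S
  = if allowed Ne S && ((x, s) \in S) then G (occupied S) (num_up S + u - s)%N else 0.
Proof.
have support_set_spin T :
    hop_elt C (x, s) (x, u) S T * amplitude (spin_sym_vec Ne G) T != 0 ->
    [/\ allowed Ne T, (x, u) \in T & S = set_spin x s u T].
  rewrite amplitude_spin_sym_vec; case: ifP => T_allowed; last by rewrite mulr0 eqxx.
  have [xT|xT] := boolP ((x, u) \in T); last by rewrite /hop_elt (negPf xT) mul0r eqxx.
  rewrite hop_elt_spin ?(allowed_single_occ T_allowed) //.
  by case: (S =P _) => // _; rewrite mul0r eqxx.
rewrite ccre_cann amplitude_opmx; case: ifP => [/andP[S_allowed xS]|not_S]; last first.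
  apply: big1 => T _; apply/eqP; apply: contraFT not_S.
  move=> /support_set_spin[T_allowed xT ->].
  by rewrite allowed_set_spin // setU11.
have S_single := allowed_single_occ S_allowed.
rewrite (bigD1 (set_spin x u s S)) //= big1 ?addr0 => [|T occ_T]; last first.
  apply/eqP; apply: contraNT occ_T => /support_set_spin[T_allowed xT ->].
  by rewrite set_spinK // (allowed_single_occ T_allowed).
rewrite hop_elt_spin ?single_occ_set_spin ?setU11 // set_spinK // eqxx mul1r.
rewrite amplitude_spin_sym_vec allowed_set_spin // occupied_set_spin //.
by congr (G _ _); have := num_up_set_spin u S_single xS; lia.
Qed.

(* Each of the [k] up electrons contributes the first row of the Pauli matrix, each of
   the [Ne - k] down electrons the second. *)
Definition spin_op (a : 'I_3) G (X : {set 'I_Ns}) (k : nat) : C :=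
  2%:R^-1 * (k%:R * (pauli C a true true * G X k + pauli C a true false * G X k.-1)
    + (Ne%:R - k%:R) * (pauli C a false true * G X k.+1 + pauli C a false false * G X k)).

Lemma amplitude_Stot a v S : amplitude (Stot C Ns a *m v) S
  = 2%:R^-1 * \sum_x \sum_s \sum_u
      pauli C a s u * amplitude (ccre C (x, s) *m cann C (x, u) *m v) S.
Proof.
rewrite /Stot -scalemxAl amplitudeZ mulmx_suml amplitude_sum; congr (_ * _).
apply: eq_bigr => x _; rewrite mulmx_suml amplitude_sum; apply: eq_bigr => s _.
rewrite mulmx_suml amplitude_sum; apply: eq_bigr => u _.
by rewrite -scalemxAl amplitudeZ.
Qed.

Lemma Stot_spin_sym_vec a G :
  Stot C Ns a *m spin_sym_vec Ne G = spin_sym_vec Ne (spin_op a G).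
Proof.
apply: amplitude_inj => S; rewrite amplitude_Stot amplitude_spin_sym_vec.
under eq_bigr do under eq_bigr do under eq_bigr do rewrite amplitude_spin_hop.
case: ifP => S_allowed /=; last first.
  by rewrite big1 ?mulr0 // => x _; rewrite !big_bool !mulr0 /= !addr0.
have [S_single cardS] : single_occ S /\ #|S| = Ne.
  by move: S_allowed => /and3P[/eqP].
rewrite /spin_op; congr (_ * _); set k := num_up S.
have upE : k%:R = \sum_x ((x, true) \in S)%:R :> C by rewrite /k num_up_sum natr_sum.
have downE : Ne%:R - k%:R = \sum_x ((x, false) \in S)%:R :> C.
  apply/eqP; rewrite subr_eq upE -big_split /= -cardS card_occupied // card_sum_mem.
  rewrite natr_sum; apply/eqP/eq_bigr => x _.
  by rewrite -noccE // addrC -natrD.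
rewrite downE {1}upE !mulr_suml -big_split /=; apply: eq_bigr => x _.
rewrite !big_bool /= !addn0 !addn1 !subn1 !subn0 /=.
by do 2!case: (_ \in S); rewrite ?mulr0 ?mul1r ?mul0r ?addr0 ?add0r.
Qed.

Lemma spin_op_sq G X k : \sum_(a < 3) spin_op a (spin_op a G) X k
  = (Ne%:R / 2%:R) * (Ne%:R / 2%:R + 1) * G X k.
Proof.
rewrite !big_ord_recl big_ord0 /spin_op /pauli /=.
have i2 : 'i * 'i = -1 :> C by rewrite -expr2 sqrCi.
have half2 : 2%:R * 2%:R^-1 = 1 :> C by rewrite mulfV ?pnatr_eq0.
move: (2%:R^-1 : C) half2 => half half2.
case: k => [|k] /=; first by ring: i2 half2.
by rewrite -(natr1 k.+1) -(natr1 k); ring: i2 half2.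
Qed.

Lemma Ssq_spin_sym_vec G : Ssq C Ns *m spin_sym_vec Ne G
  = ((Ne%:R / 2%:R) * (Ne%:R / 2%:R + 1)) *: spin_sym_vec Ne G.
Proof.
rewrite /Ssq mulmx_suml; under eq_bigr do rewrite -mulmxA !Stot_spin_sym_vec.
apply: amplitude_inj => S; rewrite amplitude_sum spin_sym_vecZ amplitude_spin_sym_vec.
under eq_bigr do rewrite amplitude_spin_sym_vec.
by case: ifP => _; rewrite ?spin_op_sq // big1.
Qed.

End TotalSpin.

(** * The effective Hamiltonian *)

Section Ring.
Variable n : nat.
Local Notation N := n.+2.
Implicit Types (x z : 'I_N) (X : {set 'I_N}).

Lemma nxtE x : nxt x = x + 1.
Proof. by apply: val_inj; rewrite /= modnDmr addn1. Qed.

Lemma Zp_natr_eq0 k : (k%:R == 0 :> 'I_N) = (N %| k)%N.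
Proof. by rewrite Zp_nat -val_eqE. Qed.

Lemma sum_site_mod (V : nmodType) (F : 'I_N -> V) k :
  \sum_(x : 'I_N | val x == (k %% N)%N) F x = F k%:R.
Proof. by rewrite (big_pred1 k%:R) // => x; rewrite /= Zp_nat -val_eqE. Qed.

Lemma val_addr_natr x k : (x + k%:R : 'I_N) = ((x + k) %% N)%N :> nat.
Proof. by rewrite Zp_nat /= modnDmr. Qed.

Lemma even_between_add1 X x : odd #|X| -> (x \in X) != (x + 1 \in X) ->
  ~~ odd #|[set z in X | between x (x + 1) z]|.
Proof.
move=> oddX ends_neq; have x_lt := ltn_ord x; have val_add1 := val_addr_natr x 1.
have [x1_lt|x1_lt] := ltnP x.+1 N.
  by rewrite eq_card0 // => z; rewrite !inE /between val_add1 modn_small; lia.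
rewrite odd_between_outside // eq_card0 // => z.
have x_wrap : (x + 1 = N)%N by lia.
by have := ltn_ord z; rewrite !inE /outside val_add1 x_wrap modnn; lia.
Qed.

Lemma odd_between_add2 X x : (0 < n)%N -> odd #|X| ->
  (forall z, (z \in X) || (z + 1 \in X)) -> (x \in X) != (x + 2%:R \in X) ->
  odd #|[set z in X | between x (x + 2%:R) z]|.
Proof.
move=> n_gt0 oddX no_holes ends_neq.
have mem_add1 : x + 1 \in X.
  have := no_holes x; have := no_holes (x + 1); rewrite -addrA -mulr2n.
  by move: ends_neq; do 3!case: (_ \in X).
suff odd_of_single P : P =1 pred1 (x + 1) -> odd #|[set z in X | P z]|.
  have val_add2 := val_addr_natr x 2; have x_lt := ltn_ord x.
  have eq_add1 z : (z == x + 1) = (z == (x + 1) %% N :> nat)%N.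
    by rewrite -(val_addr_natr x 1) (inj_eq val_inj).
  have [x2_lt|x2_lt] := ltnP x.+2 N.
    by apply: odd_of_single => z; rewrite /between val_add2 /= eq_add1 !modn_small; lia.
  rewrite odd_between_outside //; apply: odd_of_single => z.
  have z_lt := ltn_ord z; rewrite /outside val_add2 /= eq_add1.
  have [x_wrap|x_wrap] : (x + 1 = N \/ x + 2 = N)%N by lia.
    have -> : (x + 2 = N + 1)%N by lia.
    by rewrite x_wrap modnn modnDl modn_small; lia.
  by rewrite x_wrap modnn modn_small; lia.
move=> P_single; rewrite (_ : [set z in X | P z] = [set x + 1]) ?cards1 //.
apply/setP => z; rewrite !inE P_single /=.
by case: eqP => [->|]; rewrite ?mem_add1 ?andbF.
Qed.

Definition bond_left (b : 'I_N + 'I_N./2) : 'I_N :=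
  match b with inl x => x | inr j => (2 * j).+1%:R end.

Definition bond_right (b : 'I_N + 'I_N./2) : 'I_N :=
  bond_left b + (if b is inl _ then 1 else 2%:R).

Definition bond_swap b : {perm 'I_N} := tperm (bond_left b) (bond_right b).

End Ring.

Section EffectiveHamiltonian.
Variables (C : numClosedFieldType) (n Ne : nat) (t t' : C).
Local Notation N := n.+2.
Hypotheses (n_gt0 : (0 < n)%N) (oddNe : odd Ne) (N_le : (N <= 2 * Ne)%N).
Implicit Types (S T : fock N) (X : {set 'I_N}) (x y z : 'I_N).

Definition hop_adj S T : bool :=
  [&& allowed Ne S, allowed Ne T &
      [exists b, hops (bond_left b) (bond_right b) S T]].

Lemma hop_adj_sym : symmetric hop_adj.
Proof.
move=> S T; rewrite /hop_adj andbCA; congr [&& _, _ & _].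
by apply: eq_existsb => b; rewrite hops_sym.
Qed.

Definition bond_weight (b : 'I_N + 'I_N./2) : C := if b is inl _ then t else t'.

Definition hop_amplitude S T : C :=
  \sum_b bond_weight b * (hops (bond_left b) (bond_right b) S T)%:R.

Lemma cann_atE k s : cann_at C N k s = cann C (k%:R : 'I_N, s).
Proof. exact: sum_site_mod (fun x => cann C (x, s)) k. Qed.

Lemma ccre_atE k s : ccre_at C N k s = ccre C (k%:R : 'I_N, s).
Proof. exact: sum_site_mod (fun x => ccre C (x, s)) k. Qed.

Lemma bondE a b : bond C N a b = opmx (bond_elt C a%:R b%:R).
Proof.
rewrite /bond -opmx_sum; apply: eq_bigr => s _.
by rewrite !cann_atE !ccre_atE !ccre_cann opmxD.
Qed.

Lemma HhopE : Hhop N t t' = opmx (fun S T =>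
  - t * (\sum_x bond_elt C x (x + 1) S T)
  + t' * (\sum_(j < N./2) bond_elt C (2 * j).+1%:R ((2 * j).+1%:R + 2%:R) S T)).
Proof.
rewrite /Hhop -opmxD -!opmxZ -!opmx_sum; congr (_ *: _ + _ *: _).
  by apply: eq_bigr => x _; rewrite bondE -natr1 natr_Zp.
by apply: eq_bigr => j _; rewrite bondE -natrD addn2.
Qed.

Lemma bond_elt_add1 S T x : allowed Ne S -> allowed Ne T ->
  bond_elt C x (x + 1) S T = (hops x (x + 1) S T)%:R.
Proof.
rewrite !allowedE // => /andP[S_single _] /andP[T_single /andP[/eqP cardT _]].
rewrite bond_eltE //; last by rewrite -subr_eq0 opprD addNKr oppr_eq0 oner_eq0.
have [/andP[ends_neq _]|_] := boolP (hops _ _ _ _); last by rewrite mul0r.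
by rewrite -signr_odd (negPf (even_between_add1 _ ends_neq)) ?cardT // mulr1.
Qed.

Lemma bond_elt_add2 S T x : allowed Ne S -> allowed Ne T ->
  bond_elt C x (x + 2%:R) S T = - (hops x (x + 2%:R) S T)%:R.
Proof.
rewrite !allowedE // => /andP[S_single _] /andP[T_single /andP[/eqP cardT no_holes]].
rewrite bond_eltE //; last first.
  by rewrite eq_sym -subr_eq0 addrC addKr Zp_natr_eq0 gtnNdvd.
have [/andP[ends_neq _]|_] := boolP (hops _ _ _ _); last by rewrite mul0r oppr0.
rewrite -signr_odd odd_between_add2 ?cardT ?mulrN1 // => z.
by have := forallP no_holes z; rewrite nxtE.
Qed.

Lemma HeffE : Heff N Ne t t' = opmx (fun S T =>
  if allowed Ne S && allowed Ne T then - hop_amplitude S T else 0).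
Proof.
rewrite /Heff HhopE Pproj_sandwich; apply: eq_opmx => S T.
case: ifP => // /andP[S_allowed T_allowed].
rewrite /hop_amplitude big_sumType /= opprD mulNr.
congr (- _ + _).
  by rewrite mulr_sumr; apply: eq_bigr => x _; rewrite bond_elt_add1.
rewrite mulr_sumr -sumrN; apply: eq_bigr => j _.
by rewrite bond_elt_add2 // mulrN.
Qed.

Lemma HeffT : (Heff N Ne t t')^T = Heff N Ne t t'.
Proof.
apply/matrixP => i j; rewrite HeffE !mxE andbC; case: ifP => // _.
by congr (- _); apply: eq_bigr => b _; rewrite hops_sym.
Qed.

Definition movable b X : bool :=
  ((bond_left b \in X) != (bond_right b \in X)) && packed Ne (bond_swap b @^-1: X).

Lemma amplitude_Heff v S : amplitude (Heff N Ne t t' *m v) S = if allowed Ne S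
  then - \sum_(b | movable b (occupied S))
           bond_weight b * amplitude v (permute_sites (bond_swap b) S)
  else 0.
Proof.
rewrite HeffE amplitude_opmx; case: ifP => S_allowed /=; last first.
  by rewrite big1 // => T _; rewrite mul0r.
under eq_bigr do rewrite (fun_if (fun a => a * _)) mul0r mulNr mulr_suml.
rewrite -big_mkcond sumrN exchange_big [in RHS]big_mkcond; congr (- _).
apply: eq_bigr => b _; under eq_bigr do rewrite -mulrA mulrCA.
rewrite /movable -occupied_permute.
have S_single : single_occ (permute_sites (bond_swap b) S).
  by rewrite single_occ_permute (allowed_single_occ S_allowed).
have -> : packed Ne (occupied (permute_sites (bond_swap b) S))
    = allowed Ne (permute_sites (bond_swap b) S) by rewrite allowedE // S_single.
under eq_bigr do rewrite hops_sym /hops -/(bond_swap b).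
case: ifP => [/andP[-> T_allowed]|not_movable].
  rewrite (bigD1 (permute_sites (bond_swap b) S)) //= eqxx mul1r big1 ?addr0 //.
  by move=> T /andP[_ /negPf->]; rewrite mul0r.
rewrite big1 // => T T_allowed; case: andP => [[ends /eqP TE]|_]; last by rewrite mul0r.
by rewrite ends -TE T_allowed in not_movable.
Qed.

Definition hop_op (g : {set 'I_N} -> C) X : C :=
  - \sum_(b | movable b X) bond_weight b * g (bond_swap b @^-1: X).

Definition spin_sum v X : C :=
  \sum_(S | single_occ S && (occupied S == X)) amplitude v S.

(* The hopping amplitudes do not depend on the spins. *)
Lemma spin_sum_Heff v X : packed Ne X ->
  spin_sum (Heff N Ne t t' *m v) X = hop_op (spin_sum v) X.
Proof.
move=> X_packed; rewrite /spin_sum /hop_op.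
transitivity (- \sum_(S | single_occ S && (occupied S == X)) \sum_(b | movable b X)
    bond_weight b * amplitude v (permute_sites (bond_swap b) S)).
  rewrite -sumrN; apply: eq_bigr => S /andP[S_single /eqP SX].
  by rewrite amplitude_Heff allowedE // S_single SX X_packed.
rewrite exchange_big; congr (- _); apply: eq_bigr => b _; rewrite -mulr_sumr.
congr (_ * _); rewrite [RHS](reindex_inj (can_inj (permute_sitesK (bond_swap b)))) /=.
apply: eq_bigl => S; rewrite single_occ_permute occupied_permute.
by rewrite (inj_eq (@perm_preimset_inj _ _)).
Qed.

Lemma Heff_spin_sym_vec G : Heff N Ne t t' *m spin_sym_vec Ne G
  = spin_sym_vec Ne (fun X k => hop_op (G^~ k) X).
Proof.
apply: amplitude_inj => S; rewrite amplitude_Heff amplitude_spin_sym_vec.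
case: ifP => // S_allowed; congr (- _); apply: eq_bigr => b /andP[_ b_packed].
rewrite amplitude_spin_sym_vec allowedE // single_occ_permute occupied_permute b_packed.
by move: S_allowed; rewrite num_up_permute allowedE // => /andP[->].
Qed.

Lemma Heff_lift_spin_sum v E (c : nat -> C) : Heff N Ne t t' *m v = E *: v ->
  let w := spin_sym_vec Ne (fun X k => c k * spin_sum v X) in
  Heff N Ne t t' *m w = E *: w.
Proof.
move=> Hv /=; rewrite Heff_spin_sym_vec spin_sym_vecZ; apply: amplitude_inj => S.
rewrite !amplitude_spin_sym_vec allowedE //; case: ifP => // /andP[_ S_packed].
rewrite mulrCA -[E * _](_ : spin_sum (E *: v) (occupied S) = _); last first.
  by rewrite /spin_sum mulr_sumr; apply: eq_bigr => T _; rewrite amplitudeZ.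
rewrite -Hv spin_sum_Heff // /hop_op mulrN mulr_sumr; congr (- _).
by apply: eq_bigr => b _; rewrite mulrCA.
Qed.

Hypotheses (t_gt0 : 0 < t) (t'_gt0 : 0 < t').

Lemma bond_weight_gt0 b : 0 < bond_weight b.
Proof. by case: b. Qed.

Lemma hop_amplitude_ge0 S T : 0 <= hop_amplitude S T.
Proof. by apply: sumr_ge0 => b _; rewrite mulr_ge0 ?ler0n // ltW ?bond_weight_gt0. Qed.

Lemma Heff_le0 i j : Heff N Ne t t' i j <= 0.
Proof. by rewrite HeffE mxE; case: ifP => // _; rewrite oppr_le0 hop_amplitude_ge0. Qed.

Lemma Heff_hermsym : Heff N Ne t t' \is hermsymmx.
Proof.
apply: realsym_hermsym; first by apply/is_hermitianmxP; rewrite scale1r map_mx_id ?HeffT.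
by apply/mxOverP => i j; apply: ler0_real; exact: Heff_le0.
Qed.

Lemma Heff_hop_adj S T : hop_adj S T ->
  Heff N Ne t t' (enum_rank S) (enum_rank T) != 0.
Proof.
move=> /and3P[S_allowed T_allowed /existsP[b hop_b]].
rewrite HeffE opmx_rank S_allowed T_allowed oppr_eq0.
rewrite /hop_amplitude (bigD1 b) //= hop_b mulr1 gt_eqF // ltr_pwDl ?bond_weight_gt0 //.
by apply: sumr_ge0 => b' _; rewrite mulr_ge0 ?ler0n // ltW ?bond_weight_gt0.
Qed.

Lemma Heff_connect S T : connect hop_adj S T ->
  connect [rel i j | Heff N Ne t t' i j != 0] (enum_rank S) (enum_rank T).
Proof.
move=> /connectP[p pth ->]; elim: p S pth => //= R p IH S /andP[SR pth].
by apply: connect_trans (IH R pth); apply: connect1; exact: Heff_hop_adj.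
Qed.

End EffectiveHamiltonian.

(** * Connectivity of the configurations with given spin *)

(* A ring without adjacent holes, read from a site that follows an electron, is a
   sequence of tiles: an electron [(false, s)], or a hole and an electron [(true, s)]. *)
Definition tile (m : bool * bool) : seq (option bool) :=
  if m.1 then [:: None; Some m.2] else [:: Some m.2].

Definition word (ts : seq (bool * bool)) : seq (option bool) := flatten (map tile ts).

Lemma word_cat ts us : word (ts ++ us) = word ts ++ word us.
Proof. by rewrite /word map_cat flatten_cat. Qed.

Lemma word_cons m ts : word (m :: ts) = tile m ++ word ts.
Proof. by []. Qed.

Lemma size_word ts : size (word ts) = (size ts + count id (unzip1 ts))%N.
Proof.
by elim: ts => //= -[m s] ts IH; rewrite /word /= size_cat IH; case: m => /=; lia.
Qed.

Lemma count_isSome_word ts : count isSome (word ts) = size ts.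
Proof.
by elim: ts => //= -[m s] ts IH; rewrite /word /= count_cat IH; case: m.
Qed.

Lemma count_up_word ts : count (pred1 (Some true)) (word ts) = count id (unzip2 ts).
Proof.
by elim: ts => //= -[m s] ts IH; rewrite /word /= count_cat IH; case: m; case: s.
Qed.

Definition no_hole_pair (a b : option bool) : bool := isSome a || isSome b.

Lemma wordP s W : reflect (exists ts, word ts = W)
  (path no_hole_pair (Some s) W && isSome (last (Some s) W)).
Proof.
apply: (iffP andP) => [[]|[ts <-{W}]]; last first.
  elim: ts s => //= -[m u] ts IH s; rewrite /word /= cat_path last_cat -/(word ts).
  by case: m => /=; exact: IH.
have [k] := ubnP (size W); elim: k s W => // k IH s [|[u|] W] /=.
- by exists [::].
- rewrite ltnS => W_lt W_path W_last; have [ts <-] := IH u W W_lt W_path W_last.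
  by exists ((false, u) :: ts).
case: W => [|[u|] W] //= W_lt W_path W_last.
have [ts <-] := IH u W (ltnW W_lt) W_path W_last.
by exists ((true, u) :: ts).
Qed.

Section RingWords.
Variable n : nat.
Local Notation N := n.+2.
Implicit Types (S : fock N) (x z : 'I_N) (W : seq (option bool)).

Definition word_conf z W : fock N :=
  [set m : mode N | nth None W (m.1 - z)%R == Some m.2].

Lemma val_Zp_natr i : (i < N)%N -> (i%:R : 'I_N) = i :> nat.
Proof. by move=> i_lt; rewrite Zp_nat /= modn_small. Qed.

Lemma site_split z x : exists2 i, (i < N)%N & x = z + i%:R.
Proof. by exists (x - z : 'I_N) => //; rewrite natr_Zp addrC subrK. Qed.

Lemma eq_site z i j : (i < N)%N -> (j < N)%N ->
  (z + i%:R == z + j%:R :> 'I_N) = (i == j).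
Proof.
by move=> i_lt j_lt; rewrite (inj_eq (addrI z)) -(inj_eq (@ord_inj N)) !val_Zp_natr.
Qed.

Lemma mem_word_conf z W i s : (i < N)%N ->
  ((z + i%:R, s) \in word_conf z W) = (nth None W i == Some s).
Proof. by move=> i_lt; rewrite inE [_.1]/= [_.2]/= addrAC subrr add0r val_Zp_natr. Qed.

Lemma single_occ_word_conf z W : single_occ (word_conf z W).
Proof. by apply/forallP => x; rewrite !inE; case: nth => [[]|]. Qed.

Lemma occupied_word_conf z W i : (i < N)%N ->
  (z + i%:R \in occupied (word_conf z W)) = isSome (nth None W i).
Proof. by move=> i_lt; rewrite in_set !mem_word_conf //; case: nth => [[]|]. Qed.

Lemma eq_word_conf z S W :
  (forall i s, (i < N)%N -> ((z + i%:R, s) \in S) = (nth None W i == Some s)) ->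
  S = word_conf z W.
Proof.
move=> S_letters; apply/setP => -[x s]; have [i i_lt ->] := site_split z x.
by rewrite S_letters // mem_word_conf.
Qed.

Lemma sum_sites (F : 'I_N -> nat) z : (\sum_x F x = \sum_(i < N) F (z + i%:R)%R)%N.
Proof.
rewrite (reindex_inj (addrI z)); apply: eq_bigr => i _.
by rewrite natr_Zp.
Qed.

Lemma num_up_word_conf z W : size W = N ->
  num_up (word_conf z W) = count (pred1 (Some true)) W.
Proof.
move=> size_W; rewrite num_up_sum (sum_sites _ z) -(sum_nth_count None _ size_W).
by apply: eq_bigr => i _; rewrite mem_word_conf.
Qed.

Lemma card_word_conf z W : size W = N -> #|word_conf z W| = count isSome W.
Proof.
move=> size_W; rewrite card_occupied ?single_occ_word_conf // card_sum_mem.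
rewrite (sum_sites _ z) -(sum_nth_count None _ size_W).
by apply: eq_bigr => i _; rewrite occupied_word_conf.
Qed.

Lemma word_conf_rot z W1 W2 : size (W1 ++ W2) = N ->
  word_conf z (W1 ++ W2) = word_conf (z + (size W1)%:R) (W2 ++ W1).
Proof.
rewrite size_cat => size_W; apply: eq_word_conf => i s i_lt.
rewrite -addrA -natrD nth_cat; have [iW|iW] := ltnP i (size W2).
  by rewrite mem_word_conf ?nth_cat ?ltnNge ?leq_addr /= ?addKn //; lia.
have -> : (size W1 + i = N + (i - size W2))%N by lia.
rewrite natrD (eqP (_ : N%:R == 0)) ?Zp_natr_eq0 // add0r.
by rewrite mem_word_conf ?nth_cat; [case: ltnP => //|]; lia.
Qed.

Lemma hops_word_conf z W1 W2 W3 a b (i := size W1) (j := (i + (size W2).+1)%N) :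
  (j < N)%N -> isSome a != isSome b ->
  hops (z + i%:R) (z + j%:R)
    (word_conf z (W1 ++ a :: W2 ++ b :: W3)) (word_conf z (W1 ++ b :: W2 ++ a :: W3)).
Proof.
move=> j_lt kinds_neq; have i_lt : (i < N)%N by lia.
have assoc c d : W1 ++ c :: W2 ++ d :: W3 = (W1 ++ c :: W2) ++ d :: W3 by rewrite -catA.
have nth_i c d : nth None (W1 ++ c :: W2 ++ d :: W3) i = c by exact: nth_size_cat.
have nth_j c d : nth None (W1 ++ c :: W2 ++ d :: W3) j = d.
  have -> : j = size (W1 ++ c :: W2) by rewrite size_cat.
  by rewrite assoc nth_size_cat.
rewrite /hops !occupied_word_conf // nth_i nth_j eq_sym kinds_neq.
apply/eqP/esym/eq_word_conf => k s k_lt.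
rewrite inE /= permE /= !eq_site //; case: eqVneq => [->|k_neq_i].
  by rewrite mem_word_conf // nth_j nth_i.
case: eqVneq => [->|k_neq_j]; first by rewrite mem_word_conf // nth_j nth_i.
rewrite mem_word_conf // (nth_cat_cons_neq _ b a) // !assoc.
by rewrite (nth_cat_cons_neq _ a b) // size_cat.
Qed.

End RingWords.

Section HopConnectivity.
Variables n Ne : nat.
Local Notation N := n.+2.
Hypotheses (Ne_lt : (Ne < N)%N) (N_lt : (N < 2 * Ne)%N).
Implicit Types (S T : fock N) (x y z : 'I_N) (ms w : seq bool).

Local Notation adj := (@hop_adj n Ne).

Definition ref_marks : seq bool := nseq (N - Ne) true ++ nseq (2 * Ne - N) false.

Definition tiling z ms w : fock N := word_conf z (word (zip ms w)).

Lemma perm_ref_marks ms :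
  perm_eq ms ref_marks = (size ms == Ne) && (count id ms == N - Ne)%N.
Proof.
rewrite perm_eq_bool size_cat count_cat !size_nseq !count_nseq mul1n mul0n addn0.
by congr ((_ == _) && _); lia.
Qed.

Lemma size_word_zip ms w : perm_eq ms ref_marks -> size w = Ne ->
  size (word (zip ms w)) = N.
Proof.
rewrite perm_ref_marks => /andP[/eqP size_ms /eqP count_ms] size_w.
by rewrite size_word size_zip unzip1_zip size_ms size_w ?minnn ?count_ms //; lia.
Qed.

Lemma allowed_tiling z ms w : perm_eq ms ref_marks -> size w = Ne ->
  allowed Ne (tiling z ms w).
Proof.
move=> ms_perm size_w; have size_W := size_word_zip ms_perm size_w.
move: ms_perm; rewrite perm_ref_marks => /andP[/eqP size_ms _].
rewrite allowedE ?(ltnW N_lt) // single_occ_word_conf /packed.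
rewrite -card_occupied ?single_occ_word_conf // card_word_conf // count_isSome_word.
rewrite size_zip size_ms size_w minnn eqxx /=.
have /andP[W_path W_last] := introT (wordP true (word (zip ms w))) (ex_intro _ _ erefl).
apply/forallP => x; have [i i_lt ->] := site_split z x.
rewrite nxtE -addrA natr1 occupied_word_conf //; have [i1_lt|i1_lt] := ltnP i.+1 N.
  rewrite occupied_word_conf //.
  by move/(pathP None): W_path => /(_ i.+1); rewrite size_W; apply.
have size_Wi : size (word (zip ms w)) = i.+1 by lia.
by move: W_last; rewrite (last_nth None) size_Wi /= => ->.
Qed.

Lemma num_up_tiling z ms w : perm_eq ms ref_marks -> size w = Ne ->
  num_up (tiling z ms w) = count id w.
Proof.
move=> ms_perm size_w; rewrite num_up_word_conf ?size_word_zip // count_up_word.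
move: ms_perm; rewrite perm_ref_marks => /andP[/eqP size_ms _].
by rewrite unzip2_zip // size_ms size_w.
Qed.

Lemma allowed_is_tiling S : allowed Ne S ->
  exists z ms w, [/\ perm_eq ms ref_marks, size w = Ne & S = tiling z ms w].
Proof.
rewrite allowedE ?(ltnW N_lt) // => /andP[S_single /andP[/eqP cardS /forallP no_holes]].
have /card_gt0P[y yS] : (0 < #|occupied S|)%N by rewrite cardS; lia.
pose letter x : option bool := if (x, true) \in S then Some true else
  if (x, false) \in S then Some false else None.
have letter_mem x s : (letter x == Some s) = ((x, s) \in S).
  rewrite /letter; have := forallP S_single x.
  by case: s; do 2!case: (_ \in S).
have letter_occ x : isSome (letter x) = (x \in occupied S).
  by rewrite /letter inE; do 2!case: (_ \in S).
pose W := mkseq (fun i => letter (y + 1 + i%:R)) N.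
have /wordP[ts tsW] : path no_hole_pair (Some true) W && isSome (last (Some true) W).
  apply/andP; split.
    apply/(pathP None) => -[|i] //; rewrite size_mkseq => i_lt.
    rewrite [nth _ (_ :: _) _]/= !nth_mkseq // ?(ltnW i_lt) //.
    by rewrite /no_hole_pair !letter_occ -natr1 addrA -[_ + _ + 1]nxtE.
  rewrite (last_nth None) size_mkseq -[nth _ _ _]/(nth None W n.+1).
  rewrite nth_mkseq // letter_occ -addrA nat1r.
  by rewrite (eqP (_ : N%:R == 0)) ?Zp_natr_eq0 // addr0.
have S_def : S = word_conf (y + 1) W.
  by apply: eq_word_conf => i s i_lt; rewrite nth_mkseq // letter_mem.
have size_W : size W = N by rewrite size_mkseq.
have size_ts : size ts = Ne.
  by rewrite -count_isSome_word tsW -(card_word_conf (y + 1)) // -S_def card_occupied.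
exists (y + 1), (unzip1 ts), (unzip2 ts).
rewrite /tiling zip_unzip tsW size_map; split=> //.
rewrite perm_ref_marks size_map size_ts eqxx /=.
by have := size_word ts; rewrite tsW size_W size_ts; lia.
Qed.

Lemma hop_adj_marks z s1 s2 a b w1 w2 : size s1 = size w1 ->
  perm_eq (s1 ++ [:: true, false & s2]) ref_marks -> size (w1 ++ [:: a, b & w2]) = Ne ->
  adj (tiling z (s1 ++ [:: true, false & s2]) (w1 ++ [:: a, b & w2]))
      (tiling z (s1 ++ [:: false, true & s2]) (w1 ++ [:: a, b & w2])).
Proof.
move=> size_s1 ms_perm size_w; have size_W := size_word_zip ms_perm size_w.
apply/and3P; split; [exact: allowed_tiling | apply: allowed_tiling => // |].
  by apply: perm_trans ms_perm; rewrite perm_cat2l perm_cons2C.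
apply/existsP; exists (inl (z + (size (word (zip s1 w1)))%:R)).
move: size_W; rewrite /tiling !zip_cat //= !word_cat !word_cons !size_cat.
rewrite /bond_right /= => size_W.
rewrite -addrA natr1 -[(size _).+1]addn1.
by apply: (hops_word_conf _ (W2 := [::])); rewrite //=; lia.
Qed.

(* The reading starts at [1] because the [t'] bonds join the odd labels. *)
Lemma hop_adj_spins a b c ms w :
  perm_eq [:: true, false, false & ms] ref_marks -> size [:: a, b, c & w] = Ne ->
  adj (tiling 1 [:: true, false, false & ms] [:: a, b, c & w])
      (tiling 1 [:: false, false, true & ms] [:: b, a, c & w]).
Proof.
move=> ms_perm size_w.
apply/and3P; split; [exact: allowed_tiling | apply: allowed_tiling => // |].
  by apply: perm_trans ms_perm; rewrite (perm_catCA [:: false; false] [:: true]).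
apply/existsP; exists (inr ord0).
rewrite /tiling !word_cons /bond_right /= muln0 -{1}[1%:R]addr0.
by apply: (hops_word_conf 1 (W1 := [::]) (W2 := [:: Some a])); rewrite //=; lia.
Qed.

Lemma exists_hop_adj : exists S T, adj S T.
Proof.
pose ms := nseq (N - Ne).-1 true ++ nseq (2 * Ne - N).-1 false.
have ms_perm : perm_eq [:: true, false & ms] ref_marks.
  by rewrite perm_ref_marks /= size_cat count_cat !size_nseq !count_nseq /=; lia.
have size_w : size [:: true, true & nseq (Ne - 2) true] = Ne by rewrite /= size_nseq; lia.
by do 2!eexists; apply: (hop_adj_marks 0 (s1 := [::]) (w1 := [::])) ms_perm size_w.
Qed.

Lemma hop_connect_sym : connect_sym adj.
Proof. exact: sym_connect_sym (@hop_adj_sym n Ne). Qed.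

Lemma connect_marks z ms ms' w : size w = Ne ->
  perm_eq ms ref_marks -> perm_eq ms' ref_marks ->
  connect adj (tiling z ms w) (tiling z ms' w).
Proof.
move=> size_w ms_perm ms'_perm.
apply: (connect_perm (F := fun ms => tiling z ms w)); last first.
  by rewrite (permPr ms'_perm).
move=> s1 x y s2 s_perm; have {}s_perm := perm_trans s_perm ms_perm.
have s1_lt : ((size s1).+1 < size w)%N.
  move: s_perm; rewrite perm_ref_marks size_cat size_w /= => /andP[/eqP<- _].
  by rewrite !addnS !ltnS leq_addr.
have [w1 [a [b [w2 [w_def size_s1]]]]] := split_two_at s1_lt.
have [<-|xy] := eqVneq x y; first exact: connect0.
rewrite w_def in size_w * => {s1_lt}; case: x y xy s_perm => [] [] //= _ s_perm.
  by apply/connect1/hop_adj_marks.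
rewrite hop_connect_sym; apply/connect1/hop_adj_marks => //.
by apply: perm_trans s_perm; rewrite perm_cat2l perm_cons2C.
Qed.

Lemma connect_roll m z a w : size (a :: w) = Ne ->
  connect adj (tiling z ref_marks (a :: w))
              (tiling (z + (size (tile (m, a)))%:R) ref_marks (rcons w a)).
Proof.
move=> size_w; have /perm_to_rem/[1!perm_sym] : m \in ref_marks.
  by rewrite mem_cat !mem_nseq; case: m; apply/orP; [left|right]; lia.
move: (rem m ref_marks) => ms ms_perm.
have size_ms : size ms = size w.
  by move: ms_perm size_w; rewrite perm_ref_marks /= => /andP[/eqP<- _] [->].
have size_W := size_word_zip ms_perm size_w.
apply: (@connect_trans _ _ (tiling z (m :: ms) (a :: w))); first exact: connect_marks.
have -> : tiling z (m :: ms) (a :: w)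
    = tiling (z + (size (tile (m, a)))%:R) (rcons ms m) (rcons w a).
  rewrite /tiling -!cats1 zip_cat // word_cat /=.
  rewrite (cats0 (tile (m, a)) : word [:: (m, a)] = tile (m, a)).
  exact: word_conf_rot.
apply: connect_marks; rewrite ?size_rcons //.
by rewrite perm_rcons.
Qed.

(* Rolling past a lone electron and past a hole-electron tile gives the same
   spins read from two neighbouring sites. *)
Lemma connect_shift1 z w : size w = Ne ->
  connect adj (tiling z ref_marks w) (tiling (z + 1) ref_marks w).
Proof.
case/lastP: w => [|w a]; first by move=> /= ?; lia.
rewrite size_rcons => size_w.
have := @connect_roll true (z - 1) a w size_w.
have := @connect_roll false (z - 1) a w size_w.
rewrite /= [z - 1 + 1]subrK (_ : z - 1 + 2%:R = z + 1); last first.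
  by rewrite mulr2n addrA subrK.
by rewrite hop_connect_sym; exact: connect_trans.
Qed.

Lemma connect_shift z z' w : size w = Ne ->
  connect adj (tiling z ref_marks w) (tiling z' ref_marks w).
Proof.
move=> size_w; have [k _ ->] := site_split z z'.
elim: k => [|k IH]; first by rewrite addr0.
by apply: connect_trans IH _; rewrite -natr1 addrA; exact: connect_shift1.
Qed.

Lemma connect_rot z w1 w2 : size (w1 ++ w2) = Ne ->
  connect adj (tiling z ref_marks (w1 ++ w2)) (tiling z ref_marks (w2 ++ w1)).
Proof.
elim: w1 w2 => [|a w1 IH] w2 /=; first by rewrite cats0.
move=> size_w; apply: connect_trans (connect_roll false z size_w) _.
have size_w' : size (w1 ++ rcons w2 a) = Ne.
  by rewrite -size_w !size_cat size_rcons /=; lia.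
rewrite -cat_rcons rcons_cat; apply: connect_trans (IH _ size_w').
by apply: connect_shift; rewrite -rcons_cat size_rcons.
Qed.

Hypothesis evenN : ~~ odd N.

Lemma connect_swap_head a b w : size [:: a, b & w] = Ne ->
  connect adj (tiling 1 ref_marks [:: a, b & w]) (tiling 1 ref_marks [:: b, a & w]).
Proof.
case: w => [|c w] size_w; first by move: size_w evenN => /=; lia.
pose ms := nseq (N - Ne).-1 true ++ nseq (2 * Ne - N - 2) false.
have ms_perm : perm_eq [:: true, false, false & ms] ref_marks.
  by rewrite perm_ref_marks /= size_cat count_cat !size_nseq !count_nseq /=; lia.
have ms_perm' : perm_eq [:: false, false, true & ms] ref_marks.
  by apply: perm_trans ms_perm; rewrite (perm_catCA [:: false; false] [:: true]).
apply: (@connect_trans _ _ (tiling 1 [:: true, false, false & ms] [:: a, b, c & w])).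
  exact: connect_marks.
apply: (@connect_trans _ _ (tiling 1 [:: false, false, true & ms] [:: b, a, c & w])).
  exact/connect1/hop_adj_spins.
exact: connect_marks.
Qed.

Lemma connect_spins w w' : size w = Ne -> perm_eq w w' ->
  connect adj (tiling 1 ref_marks w) (tiling 1 ref_marks w').
Proof.
move=> size_w; apply: (connect_perm (F := tiling 1 ref_marks)) => s1 x y s2 /perm_size.
rewrite size_w => size_swap; apply: connect_trans (connect_rot 1 size_swap) _.
apply: (@connect_trans _ _ (tiling 1 ref_marks ([:: y, x & s2] ++ s1))).
  by apply: connect_swap_head; rewrite -size_swap [RHS]size_cat addnC -size_cat.
by apply: connect_rot; rewrite -size_swap !size_cat addnC.
Qed.

Lemma allowed_connect S T : allowed Ne S -> allowed Ne T -> num_up S = num_up T ->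
  connect adj S T.
Proof.
have to_ref R : allowed Ne R -> exists w,
    [/\ size w = Ne, count id w = num_up R & connect adj R (tiling 1 ref_marks w)].
  move=> /allowed_is_tiling[z [ms [w [ms_perm size_w ->]]]]; exists w; split=> //.
    by rewrite num_up_tiling.
  apply: connect_trans (connect_shift z 1 size_w).
  exact: connect_marks.
move=> /to_ref[w [size_w count_w Sw]] /to_ref[w' [size_w' count_w' Tw']] same_num_up.
apply: (connect_trans Sw); rewrite hop_connect_sym; apply: (connect_trans Tw').
apply: connect_spins => //.
by rewrite perm_eq_bool size_w size_w' count_w count_w' same_num_up !eqxx.
Qed.

End HopConnectivity.

(** * Ground states *)

Section GroundStates.
Variables (C : numClosedFieldType) (n Ne : nat) (t t' : C).
Local Notation N := n.+2.
Local Notation H := (Heff N Ne t t').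
Hypotheses (oddNe : odd Ne) (Ne_lt : (Ne < N)%N) (N_lt : (N < 2 * Ne)%N).
Hypotheses (t_gt0 : 0 < t) (t'_gt0 : 0 < t').
Implicit Types (S T : fock N) (v : 'cV[C]_(dimF N)) (E : C).

Let N_le : (N <= 2 * Ne)%N := ltnW N_lt.

Let n_gt0 : (0 < n)%N.
Proof. by move: oddNe; lia. Qed.

Let H_herm : H \is hermsymmx := Heff_hermsym n_gt0 oddNe N_le t_gt0 t'_gt0.

Let H_le0 : forall i j, H i j <= 0 := Heff_le0 n_gt0 oddNe N_le t_gt0 t'_gt0.

(* [P H P v = E v] with [E != 0] puts [v] in the range of [P]. *)
Lemma ground_stateE E v : E != 0 -> ground_state Ne t t' E v <-> H *m v = E *: v.
Proof.
move=> E_neq0; split=> [[]//|Hv]; split=> //.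
rewrite -[v](scalerK E_neq0) -Hv -scalemxAr /Heff !mulmxA.
by rewrite Pproj_idem.
Qed.

Lemma eigenvector_forbidden E v S : E != 0 -> H *m v = E *: v ->
  ~~ allowed Ne S -> amplitude v S = 0.
Proof.
move=> E_neq0 /(congr1 (fun w => amplitude w S)) Hv /negPf not_S.
move: Hv; rewrite amplitude_Heff // not_S amplitudeZ => /esym/eqP.
by rewrite mulf_eq0 (negPf E_neq0) => /eqP.
Qed.

Section LowestEigenspace.
Variable E : C.
Hypothesis E_low : lowest_eigenvalue H E.

Lemma lowest_energy_lt0 : E < 0.
Proof.
have [S [T hop]] := exists_hop_adj Ne_lt N_lt.
apply: (lowest_eigenvalue_lt0 H_le0 E_low).
exact: (Heff_hop_adj n_gt0 oddNe N_le t_gt0 t'_gt0 hop).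
Qed.

Hypothesis evenN : ~~ odd N.

Lemma lowest_eigenvector_sector v S T : H *m v = E *: v ->
  allowed Ne S -> allowed Ne T -> num_up S = num_up T ->
  amplitude v S = 0 -> amplitude v T = 0.
Proof.
move=> Hv S_allowed T_allowed same_num_up.
have := lowest_eigenvector_eq0_connect H_herm H_le0 E_low Hv; apply.
by apply: Heff_connect => //; exact: allowed_connect.
Qed.

Lemma spin_sum_neq0 v S : v != 0 -> H *m v = E *: v -> (forall T, 0 <= amplitude v T) ->
  allowed Ne S -> spin_sum v (occupied S) != 0.
Proof.
move=> /amplitude_neq0[S0 vS0] Hv v_ge0 S_allowed.
have S0_allowed : allowed Ne S0.
  by apply: contraNT vS0 => /(eigenvector_forbidden (ltr0_neq0 lowest_energy_lt0) Hv)->.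
have spin_sum_gt0 : 0 < spin_sum v (occupied S0).
  rewrite /spin_sum (bigD1 S0) ?(allowed_single_occ S0_allowed) ?eqxx //=.
  by rewrite ltr_pwDl ?sumr_ge0 // lt0r vS0 v_ge0.
have [T [T_allowed occ_T num_up_T]] :=
  exists_allowed_spins N_le S_allowed (num_up_allowed S0_allowed).
have lift_eigen := Heff_lift_spin_sum n_gt0 oddNe N_le (fun=> 1) Hv.
have := lowest_eigenvector_sector lift_eigen T_allowed S0_allowed num_up_T.
rewrite !amplitude_spin_sym_vec T_allowed S0_allowed occ_T !mul1r => vanish.
by apply: contraTneq spin_sum_gt0 => /vanish->; rewrite ltxx.
Qed.

Lemma exists_spinless_ground_function : exists g : {set 'I_N} -> C,
  (forall S, allowed Ne S -> g (occupied S) != 0) /\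
  forall c : nat -> C, let w := spin_sym_vec Ne (fun X k => c k * g X) in H *m w = E *: w.
Proof.
have [[v v_neq0 Hv] _] := E_low; pose abs_v := map_mx Num.norm v.
have Hv_abs : H *m abs_v = E *: abs_v := lowest_eigenvector_normr H_herm H_le0 E_low Hv.
exists (spin_sum abs_v); split=> [S|c]; last exact: Heff_lift_spin_sum.
apply: spin_sum_neq0 Hv_abs _ => [|T]; last by rewrite /amplitude mxE.
by rewrite -sqnorm_gt0 sqnorm_normr sqnorm_gt0.
Qed.

Lemma lowest_eigenspace_basis : exists (g : {set 'I_N} -> C) (pt : 'I_Ne.+1 -> fock N),
  let psi (k : 'I_Ne.+1) := spin_sym_vec Ne (fun X j => (j == k)%:R * g X) in
  [/\ forall k l, (amplitude (psi k) (pt l) != 0) = (k == l),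
      forall k, H *m psi k = E *: psi k &
      forall v, H *m v = E *: v -> exists a : 'I_Ne.+1 -> C, v = \sum_k a k *: psi k].
Proof.
have [g [g_neq0 Hg]] := exists_spinless_ground_function.
have [S [_ /and3P[S_allowed _ _]]] := exists_hop_adj Ne_lt N_lt.
have /fin_all_exists[pt ptP] (k : 'I_Ne.+1) : exists T, allowed Ne T /\ num_up T = k.
  have [T [T_allowed _ num_up_T]] :=
    exists_allowed_spins N_le S_allowed (ltn_ord k : k <= Ne)%N.
  by exists T.
exists g, pt => psi.
have psi_pt k l : (amplitude (psi k) (pt l) != 0) = (k == l).
  have [T_allowed num_up_T] := ptP l.
  rewrite amplitude_spin_sym_vec T_allowed num_up_T mulf_eq0.
  by rewrite (negPf (g_neq0 _ T_allowed)) orbF pnatr_eq0 eqb0 negbK eq_sym.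
have psi_eigen k : H *m psi k = E *: psi k by exact: (Hg (fun j => (j == k)%:R)).
split=> // v; apply: (lowest_eigenspace_span H_herm H_le0 E_low psi_eigen psi_pt).
move=> u i Hu u_neq0; pose T := enum_val i.
have T_allowed : allowed Ne T.
  apply: contraNT u_neq0 => /(eigenvector_forbidden (ltr0_neq0 lowest_energy_lt0) Hu).
  by rewrite /amplitude enum_valK => ->.
pose k : 'I_Ne.+1 := Ordinal (num_up_allowed T_allowed : num_up T < Ne.+1)%N.
have [pt_allowed num_up_pt] := ptP k; exists k; rewrite -[i]enum_valK.
by apply: Heff_connect => //; exact: allowed_connect.
Qed.

End LowestEigenspace.
End GroundStates.

Theorem mainTheorem11 (C : numClosedFieldType) (Ns Ne : nat) (t t' : C) :
  ~~ odd Ns -> odd Ne -> (Ns./2 < Ne)%N -> (Ne < Ns)%N -> 0 < t -> 0 < t' ->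
  exists E0 : C,
    [/\ @is_ground_energy C Ns Ne t t' E0,
        @subspace_dim C Ns (@ground_state C Ns Ne t t' E0) Ne.+1 &
        forall v : 'cV[C]_(dimF Ns), @ground_state C Ns Ne t t' E0 v ->
          @Ssq C Ns *m v
            = ((Ne%:R / 2%:R) * (Ne%:R / 2%:R + 1)) *: v].
Proof.
case: Ns => [|[|n]] // evenN oddNe half_lt Ne_lt t_gt0 t'_gt0.
have N_lt : (n.+2 < 2 * Ne)%N by lia.
have n_gt0 : (0 < n)%N by lia.
have [|E E_low] := hermitian_lowest_eigenvalue _
  (Heff_hermsym n_gt0 oddNe (ltnW N_lt) t_gt0 t'_gt0).
  by apply/card_gt0P; exists set0.
have E_neq0 := ltr0_neq0 (lowest_energy_lt0 oddNe Ne_lt N_lt t_gt0 t'_gt0 E_low).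
have groundE v := ground_stateE Ne t t' v E_neq0.
have [g [pt [psi_pt psi_eigen psi_span]]] :=
  lowest_eigenspace_basis oddNe Ne_lt N_lt t_gt0 t'_gt0 E_low evenN.
exists E; split.
- split=> [|l [v [v_neq0 _ Hv]]]; last exact: lowest_eigenvalue_le E_low v_neq0 Hv.
  by have [[v v_neq0 /groundE[Pv Hv]] _] := E_low; exists v.
- apply: subspace_dim_basis psi_pt _ => v; rewrite groundE.
  by split=> [/psi_span//|[a ->]]; exact: eigenvector_comb.
move=> v /groundE/psi_span[a ->]; apply: eigenvector_comb => k.
by apply: Ssq_spin_sym_vec; exact: ltnW.
Qed.
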